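(* For every $n\geq 1$, $$|\mathcal{RAI}_{2n}(1243)|=|\mathcal{RAI}_{2n}(2134)|=M_n.$$
   Context: Permutations of $[N]=\{1,\ldots,N\}$ are written in one-line notation $\pi=\pi_1\pi_2\cdots\pi_N$. A permutation is reverse alternating if $\pi_1>\pi_2<\pi_3>\pi_4<\cdots$, and is an involution if $\pi=\pi^{-1}$. A permutation $\pi$ contains a permutation (pattern) $\sigma$ if some subsequence of $\pi$ is order isomorphic to $\sigma$; otherwise $\pi$ avoids $\sigma$. $\mathcal{RAI}_N(\sigma)$ denotes the set of reverse alternating involutions of $[N]$ that avoid $\sigma$. $M_n=\sum_{k=0}^{\lfloor n/2\rfloor}\frac{n!}{k!(k+1)!(n-2k)!}$ is the $n$-th Motzkin number. *)

(* Defs.v *)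
From mathcomp Require Import all_boot all_fingroup.

Set Implicit Arguments.
Unset Strict Implicit.
Unset Printing Implicit Defensive.

(* A permutation of [N] = {1, ..., N} is an element of 'S_N; both positions
   and values are shifted down by one, so pi_i of one-line notation is
   (pi (i - 1)).+1. *)
Definition one_line (N : nat) (pi : 'S_N) : seq nat :=
  [seq (nat_of_ord (pi i)).+1 | i <- enum 'I_N].

(* Because of the shift, the descents pi_1 > pi_2, pi_3 > pi_4, ... start at
   the even positions of 'I_N. *)
Definition reverse_alternating (N : nat) (pi : 'S_N) : bool :=
  [forall i : 'I_N, forall j : 'I_N, (j == i.+1 :> nat) ==>
     (if odd i then pi i < pi j else pi j < pi i)].

Definition involutive_perm (N : nat) (pi : 'S_N) : bool := pi == (pi^-1)%g.

(* f lists the positions, in increasing order, of a subsequence of pi. *)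
Definition contains (N k : nat) (pi : 'S_N) (sigma : 'S_k) : bool :=
  [exists f : {ffun 'I_k -> 'I_N},
     [forall i : 'I_k, forall j : 'I_k, (i < j) ==> (f i < f j)]
     && [forall i : 'I_k, forall j : 'I_k,
           (pi (f i) < pi (f j)) == (sigma i < sigma j)]].

Definition avoids (N k : nat) (pi : 'S_N) (sigma : 'S_k) : bool :=
  ~~ contains pi sigma.

Definition RAI (N k : nat) (sigma : 'S_k) : {set 'S_N} :=
  [set pi : 'S_N | [&& reverse_alternating pi, involutive_perm pi
                     & avoids pi sigma]].

Definition p1243 : 'S_4 := tperm (@Ordinal 4 2 isT) (@Ordinal 4 3 isT).
Definition p2134 : 'S_4 := tperm (@Ordinal 4 0 isT) (@Ordinal 4 1 isT).

Lemma one_line_p1243 : one_line p1243 = [:: 1; 2; 4; 3].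
Proof. by rewrite /one_line /p1243 !enum_ordSl enum_ord0 /= !permE. Qed.

Lemma one_line_p2134 : one_line p2134 = [:: 2; 1; 3; 4].
Proof. by rewrite /one_line /p2134 !enum_ordSl enum_ord0 /= !permE. Qed.

(* The integer quotients are exact, by motzkin_term_exact. *)
Definition motzkin (n : nat) : nat :=
  \sum_(0 <= k < (n %/ 2).+1) n`! %/ (k`! * (k.+1)`! * (n - 2 * k)`!).

Lemma motzkin_term_exact (n k : nat) :
  k <= n %/ 2 -> k`! * (k.+1)`! * (n - 2 * k)`! %| n`!.
Proof.
move=> le_k; have le_2k : 2 * k <= n by rewrite mulnC -leq_divRL.
rewrite -(bin_fact le_2k) mulnA dvdn_pmul2r ?fact_gt0 //; apply: dvdn_mull.
have le_k2 : k <= 2 * k by rewrite mul2n -addnn leq_addr.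
have def_k : 2 * k - k = k by rewrite mul2n -addnn addnK.
rewrite -(bin_fact le_k2) def_k factS mulnCA dvdn_pmul2r ?muln_gt0 ?fact_gt0 //.
have /(congr1 (dvdn k.+1)) := mul_bin_left (2 * k) k.
rewrite def_k dvdn_mulr // Gauss_dvdr //.
by rewrite coprimeSn.
Qed.

(* Main.v *)
Require Import Defs.
From mathcomp Require Import all_boot all_fingroup.
From mathcomp Require Import zify.

Set Implicit Arguments.
Unset Strict Implicit.
Unset Printing Implicit Defensive.

(** Reversal and complement exchange 1243 and 2134, so only 2134 is counted.
Call a point of a permutation inner if two larger points in increasing order
lie to its upper right.  The permutation avoids 2134 or 1234 according to a
condition on the inner points only, and in each case these points are
determined by the rows and columns they use; rearranging them therefore gives
a bijection between the two kinds of involutions.  It keeps the permutation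
reverse alternating, because all peaks are outer on the 2134 side; on the 1234
side this says that the first point is outer.  Such an involution of [2n] maps
1 to 2n or to 2n-2, and deleting this 2-cycle leaves a 1234-avoiding
involution with prescribed descents.  By the Robinson-Schensted
correspondence these are standard tableaux with at most three columns, built
by adding the boxes in pairs; adding two of three columns is complementary to
adding one, so one counts walks in the Weyl chamber of SL_3, and restriction
to SL_2 turns these into Motzkin paths. *)

(** * Growth diagrams *)

(* Fomin's local rule.  The edge between two nested shapes carries the row of the
   added box, or [None] if the shapes agree; in these terms the rule does not
   refer to the shapes. *)
Definition local_rule (a b : option nat) (m : bool) : option nat * option nat :=
  if m then (Some 0, Some 0)
  else if a == b then (omap succn a, omap succn b) else (a, b).

(** The vertical edge labels met while a row is crossed from left to right, [h] being the labels on
    its lower side and [m] its points. [hor M i j] and [ver M i j] label the edges from corner (i,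
    j) to (i, j+1) and to (i+1, j). *)
Fixpoint carry (h : nat -> option nat) (m : nat -> bool) (j : nat) :=
  if j is j'.+1 then (local_rule (h j') (carry h m j') (m j')).2 else None.

Fixpoint hor (M : nat -> nat -> bool) (i : nat) : nat -> option nat :=
  if i is i'.+1 then
    fun j => (local_rule (hor M i' j) (carry (hor M i') (M i') j) (M i' j)).1
  else fun=> None.

Definition ver M i j := carry (hor M i) (M i) j.

Definition labels (w : nat -> option nat) (n r : nat) :=
  count (fun j => w j == Some r) (iota 0 n).

(** Length of row [r] of the shape at corner (i, j), recovered from the labels on the horizontal
    path from (i, 0), where the shape is empty. *)
Definition shape M i j r := labels (hor M i) j r.

Definition partial_perm (M : nat -> nat -> bool) :=
  (forall i j j', M i j -> M i j' -> j = j') /\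
  (forall i i' j, M i j -> M i' j -> i = i').

Lemma labelsS w n r : labels w n.+1 r = labels w n r + (w n == Some r).
Proof. by rewrite /labels -addn1 iotaD count_cat /= addn0. Qed.

Lemma eq_labels w w' n r : (forall j, j < n -> w j = w' j) ->
  labels w n r = labels w' n r.
Proof.
by move=> e; apply: eq_in_count => j; rewrite mem_iota add0n => /e ->.
Qed.

Lemma local_ruleC a b m : local_rule b a m = ((local_rule a b m).2, (local_rule a b m).1).
Proof. by rewrite /local_rule; case: m => //; rewrite eq_sym; case: eqP => // ->. Qed.

Lemma isSome_rule1 a b m : isSome (local_rule a b m).1 = isSome a || m.
Proof. by rewrite /local_rule orbC; case: m => //=; case: eqP => // ->; case: b. Qed.

Lemma isSome_rule2 a b m : isSome (local_rule a b m).2 = isSome b || m.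
Proof. by rewrite /local_rule orbC; case: m => //=; case: eqP => // ->; case: b. Qed.

Lemma has_iotaS (p : pred nat) n : has p (iota 0 n.+1) = has p (iota 0 n) || p n.
Proof. by rewrite -addn1 iotaD has_cat /= orbF. Qed.

Lemma isSome_hor M i j : isSome (hor M i j) = has (fun i' => M i' j) (iota 0 i).
Proof. by elim: i => [|i IH] //; rewrite has_iotaS -IH isSome_rule1. Qed.

Lemma isSome_carry h m j : isSome (carry h m j) = has m (iota 0 j).
Proof. by elim: j => [|j IH] //; rewrite has_iotaS -IH isSome_rule2. Qed.

Lemma isSome_ver M i j : isSome (ver M i j) = has (M i) (iota 0 j).
Proof. exact: isSome_carry. Qed.

Lemma point_label M i j : partial_perm M -> M i j ->
  hor M i j = None /\ ver M i j = None.
Proof.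
case=> MU MU' Mij; split.
  case E: (hor M i j) => [a|] //; have := isSome_hor M i j; rewrite E /=.
  case/esym/hasP => i'; rewrite mem_iota => /andP[_ lt_i] Mi'.
  by have := MU' _ _ _ Mij Mi'; lia.
case E: (ver M i j) => [a|] //; have := isSome_ver M i j; rewrite E /=.
case/esym/hasP => j'; rewrite mem_iota => /andP[_ lt_j] Mi'.
by have := MU _ _ _ Mij Mi'; lia.
Qed.

Lemma horS M i j : hor M i.+1 j = (local_rule (hor M i j) (ver M i j) (M i j)).1.
Proof. by []. Qed.

Lemma verS M i j : ver M i j.+1 = (local_rule (hor M i j) (ver M i j) (M i j)).2.
Proof. by []. Qed.

(** The local rule treats its two edges alike, so transposing the points transposes the diagram. *)
Lemma hor_ver_tr M M' : (forall i j, M i j = M' j i) -> forall i j, hor M i j = ver M' j i.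
Proof.
move=> tM; elim=> [|i IH] // j.
suff E : ver M i j = hor M' j i by rewrite horS verS IH E tM local_ruleC.
elim: j => [|j IHv] //.
by rewrite verS horS IH IHv tM local_ruleC.
Qed.

Section Growth.
Variable M : nat -> nat -> bool.
Hypothesis MP : partial_perm M.

Lemma shapeS i j r : shape M i j.+1 r = shape M i j r + (hor M i j == Some r).
Proof. exact: labelsS. Qed.

(** Both paths around a cell add the same boxes, so horizontal and vertical labels describe the same
    shapes. *)
Lemma shape_up i j r : shape M i.+1 j r = shape M i j r + (ver M i j == Some r).
Proof.
elim: j => [|j IH] //; rewrite !shapeS IH -!addnA; congr addn.
rewrite horS verS.
case Mij: (M i j) => /=; first by have [-> ->] := point_label MP Mij.
rewrite /local_rule; case: (hor M i j =P ver M i j) => /= [->|_] //; exact: addnC.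
Qed.

(** If the labels of a cell differ, its last shape is the union of the two neighbours; if they
    agree, the second box goes into the next row, where the first one made room. *)
Lemma shape_partition i j r : shape M i j r.+1 <= shape M i j r.
Proof.
elim: i j r => [|i IHi] j r; first by rewrite /shape /labels (@eq_count _ _ pred0) ?count_pred0.
elim: j r => [|j IHj] r //.
have := IHi j.+1 r; have := IHj r; have := IHi j r.
rewrite !(shapeS, shape_up, horS).
case Mij: (M i j) => /=; first by have [-> ->] := point_label MP Mij; lia.
rewrite /local_rule; case: (hor M i j =P ver M i j) => /= [->|].
  by case: (ver M i j) => [a|] //=; rewrite ?eqE /=; lia.
case: (hor M i j) (ver M i j) => [a|] [b|] //=; rewrite ?eqE /=; try lia.
move=> ab; have {}ab: a <> b by congruence.
lia.
Qed.

Fixpoint chain k i j : Prop :=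
  if k is k'.+1 then exists i' j', [/\ i' < i, j' < j, M i' j' & chain k' i' j'] else True.

Lemma shape_mono0 i i' j j' : i <= i' -> j <= j' -> shape M i j 0 <= shape M i' j' 0.
Proof.
move=> /subnKC <- /subnKC <-; elim: (i' - i) => [|d IH].
  rewrite addn0; elim: (j' - j) => [|e]; first by rewrite addn0.
  by rewrite addnS shapeS; lia.
by rewrite addnS shape_up; lia.
Qed.

(** Schensted's theorem for the first row. At a corner where this row is longer than at both
    neighbours, both incoming edges have label 0, and the local rule produces this only at a point,
    which ends the chain. *)
Lemma chain_shape k i j : chain k i j <-> k <= shape M i j 0.
Proof.
split.
  elim: k i j => [|k IH] i j //= [i' [j' [ii jj Mij /IH]]].
  have := shape_mono0 ii jj; rewrite shapeS shape_up horS Mij.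
  by have [-> ->] := point_label MP Mij => /=; lia.
elim: k i j => [|k IH] //; elim=> [|i IHi].
  by move=> j; rewrite /shape /labels (@eq_count _ _ pred0) ?count_pred0.
elim=> [|j IHj] //.
rewrite leq_eqVlt => /orP[/eqP E|]; last first.
  move=> lt; have [|i' [j' [? ? ? ?]]] := IHj.
    by move: lt; rewrite shapeS; lia.
  by exists i', j'; split=> //; lia.
case: (ltnP k (shape M i.+1 j 0)) => [/IHj [i' [j' [? ? ? ?]]]|le1].
  by exists i', j'; split=> //; lia.
case: (ltnP k (shape M i j.+1 0)) => [/IHi [i' [j' [? ? ? ?]]]|le2].
  by exists i', j'; split=> //; lia.
have h1: hor M i.+1 j = Some 0.
  by apply/eqP; move: E; rewrite shapeS; lia.
have v1: ver M i j.+1 = Some 0.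
  by apply/eqP; move: E; rewrite shape_up; lia.
have Mij: M i j.
  move: h1 v1; rewrite horS verS; case: (M i j) => //.
  rewrite /local_rule; case: (hor M i j =P ver M i j) => /= [->|]; first by case: (ver M i j).
  by move=> d e1 e2; case: d; rewrite e1 e2.
exists i, j; split=> //; apply: IH; move: E.
by rewrite shapeS h1 shape_up; have [_ ->] := point_label MP Mij; rewrite /=; lia.
Qed.

(** Descents of the permutation become descents of the tableau. The later of the columns [p] and [q]
    creates a label 0 in its row, which fixes the order of the two labels; every further column
    preserves it. *)
Lemma ver_descent i p q : M i p -> M i.+1 q -> forall j, p < j -> q < j ->
  exists a b, [/\ ver M i j = Some a, ver M i.+1 j = Some b & (a < b) = (q < p)].
Proof.
move=> Mip Miq; elim=> [|j IH] // pj qj.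
have pq : p <> q by move=> e; case: MP => _ H; have := H i i.+1 p Mip; rewrite e => /(_ Miq); lia.
rewrite !verS horS.
case: (ltnP p j) => pj'; case: (ltnP q j) => qj'; last lia.
- have [a [b [-> -> <-]]] := IH pj' qj'.
  have -> : M i j = false.
    by apply/negP => Mij; case: MP => H _; have := H _ _ _ Mip Mij; lia.
  have -> : M i.+1 j = false.
    by apply/negP => Mij; case: MP => H _; have := H _ _ _ Miq Mij; lia.
  rewrite /local_rule; case: (hor M i j) => [x|] /=; last by exists a, b.
  rewrite !(inj_eq Some_inj); case: (x =P a) => /= [->|xa].
    rewrite !(inj_eq Some_inj); case: eqP => [e|ne]; first by exists a.+1, b.+1; split=> //; lia.
    by exists a.+1, b; split=> //; apply/idP/idP; lia.
  rewrite !(inj_eq Some_inj); case: eqP => [e|ne]; last by exists a, b.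
  by exists a, b.+1; split=> //; apply/idP/idP; lia.
- have qj2: q = j by lia.
  subst q; have [_ v0] := point_label MP Miq; rewrite v0 Miq /=.
  have : isSome (ver M i j) by rewrite isSome_ver; apply/hasP; exists p; rewrite ?mem_iota.
  case: (ver M i j) => [a|] // _.
  have -> : M i j = false.
    by apply/negP => Mij; case: MP => H _; have := H _ _ _ Mip Mij; lia.
  have [] := point_label MP Miq; rewrite horS => hN _.
  have h0 : hor M i j = None.
    by have := isSome_rule1 (hor M i j) (ver M i j) (M i j); rewrite hN; case: (hor M i j).
  by rewrite h0 /local_rule /=; exists a, 0; split=> //; lia.
- have pj2: p = j by lia.
  subst p; have [h0 v0] := point_label MP Mip; rewrite h0 v0 Mip /=.
  have : isSome (ver M i.+1 j) by rewrite isSome_ver; apply/hasP; exists q; rewrite ?mem_iota.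
  case: (ver M i.+1 j) => [b|] // _.
  have -> : M i.+1 j = false.
    by apply/negP => Mij; case: MP => H _; have := H _ _ _ Miq Mij; lia.
  rewrite /local_rule !(inj_eq Some_inj); case: eqP => [<-|ne]; first by exists 0, 1; split=> //; lia.
  by exists 0, b; split=> //; lia.
Qed.

End Growth.

(** * Inverting growth diagrams *)

Lemma local_rule_inj a b (m : bool) a' b' (m' : bool) :
  (m -> a = None /\ b = None) -> (m' -> a' = None /\ b' = None) ->
  local_rule a b m = local_rule a' b' m' -> [/\ a = a', b = b' & m = m'].
Proof.
rewrite /local_rule; case: m => [/(_ isT)[-> ->]|_].
  case: m' => [/(_ isT)[-> ->]|_] //.
  by case: (a' =P b') => [->|ne [e1 e2]]; [case: b'|case: ne; rewrite -e1 -e2].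
case: m' => [/(_ isT)[-> ->]|_].
  by case: (a =P b) => [->|ne [e1 e2]]; [case: b|case: ne; rewrite e1 e2].
case: (a =P b) => [->|ne]; case: (a' =P b') => [->|ne'].
- by case: b; case: b' => //= x y [->].
- by case=> e1 e2; case: ne'; rewrite -e1 -e2.
- by case=> e1 e2; case: ne; rewrite e1 e2.
- by case=> -> ->.
Qed.

Lemma row_inj h (m : nat -> bool) h' (m' : nat -> bool) n :
  (forall j, m j -> h j = None /\ carry h m j = None) ->
  (forall j, m' j -> h' j = None /\ carry h' m' j = None) ->
  carry h m n = carry h' m' n ->
  (forall j, j < n -> (local_rule (h j) (carry h m j) (m j)).1 =
                      (local_rule (h' j) (carry h' m' j) (m' j)).1) ->
  forall j, j < n -> h j = h' j /\ m j = m' j.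
Proof.
move=> V V'; elim: n => [|n IH] // Ec El j.
have := @local_rule_inj _ _ _ _ _ _ (V n) (V' n).
case; first by rewrite [LHS]surjective_pairing [RHS]surjective_pairing El //; congr pair.
move=> Eh Ec' Em.
rewrite ltnS leq_eqVlt => /orP[/eqP->//|]; apply: IH => // i lt_i; apply: El; lia.
Qed.

(** The rule is undone cell by cell, from the last row and column backwards: two labels 0 come from
    a point, other equal labels from a bump, and different labels are unchanged. *)
Lemma growth_inj M M' n N :
  partial_perm M -> partial_perm M' ->
  (forall j, j < N -> hor M n j = hor M' n j) ->
  (forall i, i < n -> ver M i N = ver M' i N) ->
  forall i j, i < n -> j < N -> M i j = M' i j.
Proof.
move=> MP MP'; elim: n => [|n IH] // Eh Ev.
have row : forall j, j < N -> hor M n j = hor M' n j /\ M n j = M' n j.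
  apply: row_inj => //; [move=> j; exact: (@point_label M n j MP)|move=> j; exact: (@point_label M' n j MP')|exact: Ev].
move=> i j; rewrite ltnS leq_eqVlt => /orP[/eqP->|lt_in] lt_j; first by case: (row j lt_j).
by apply: IH => // [j' /row[]|i' lt] //; apply: Ev; lia.
Qed.

Definition ballot (w : nat -> option nat) (n : nat) :=
  forall j r, j <= n -> labels w j r.+1 <= labels w j r.

Lemma growth_ext M M' n : (forall i j, i < n -> M i j = M' i j) ->
  forall i, i <= n -> hor M i =1 hor M' i.
Proof.
move=> E; elim=> [|i IH] // lt_i j; rewrite !horS /ver.
have {}IH := IH (ltnW lt_i); rewrite IH E //.
suff -> : carry (hor M i) (M i) j = carry (hor M' i) (M' i) j by [].
by elim: j => [|j IHj] //=; rewrite IHj IH E.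
Qed.

Lemma growth_ext_ver M M' n : (forall i j, i < n -> M i j = M' i j) ->
  forall i j, i < n -> ver M i j = ver M' i j.
Proof.
move=> E i j lt_i; elim: j => [|j IHj] //=.
by rewrite !verS IHj (growth_ext E (ltnW lt_i)) E.
Qed.

(* Undoing one row: a ballot word whose last box in row [r] is removable comes
   from a ballot word with that box removed. *)
Lemma row_surj w n b :
  ballot w n -> (forall r, b = Some r -> labels w n r.+1 < labels w n r) ->
  exists h (m : nat -> bool), [/\ carry h m n = b,
    forall j, j < n -> (local_rule (h j) (carry h m j) (m j)).1 = w j,
    forall j, m j -> [/\ j < n, h j = None & carry h m j = None],
    ballot h n & forall r, labels h n r + (b == Some r) = labels w n r].
Proof.
elim: n b => [|n IH] b bw rem.
  exists (fun=> None), (fun=> false); split=> //.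
  - by case: b rem => [r|] // /(_ r erefl).
  - by move=> r; case: b rem => [s /(_ s erefl)|_].
have bw' : ballot w n by move=> j r lt_j; apply: bw; lia.
(* The inverse local rule in the last cell: the labels of its two incoming edges, and whether it
   holds a point. *)
pose irule : option nat * option nat * bool :=
  if w n == b then
    if b is Some r then if r is q.+1 then (Some q, Some q, false) else (None, None, true)
    else (None, None, false)
  else (w n, b, false).
case E: irule => [[x b0] m0].
have Er : local_rule x b0 m0 = (w n, b).
  move: E; rewrite /irule /local_rule; case: (w n =P b) => [->|ne] [].
    by case: b {rem irule}=> [[|q]|] [<- <- <-]; rewrite ?eqxx.
  by move=> <- <- <-; case: eqP.
have Em0 : m0 -> x = None /\ b0 = None.
  move: E; rewrite /irule; case: (w n =P b) => [_|ne]; last by case=> <- <- <-.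
  by case: b {rem irule Er}=> [[|q]|] [<- <- <-].
have Ew r : (x == Some r) + (b == Some r) = (w n == Some r) + (b0 == Some r).
  move: E; rewrite /irule; case: (w n =P b) => [->|ne]; last by case=> <- <- _; lia.
  by case: b {rem irule Er} => [[|q]|] [<- <- _] //; rewrite addnC.
have rem0 r : b0 = Some r -> labels w n r.+1 < labels w n r.
  move=> eb0; have := bw n.+1 r (leqnn _); have := rem r; rewrite !labelsS.
  move: E; rewrite /irule; case: (w n =P b) => [->|ne].
    case: b {bw rem irule Er Ew} => [[|q]|] [_ eb _]; move: eb0; rewrite -eb // => -[<-].
    by rewrite !(inj_eq Some_inj) eqxx; lia.
  case=> _ eb _; rewrite eb eb0 => /(_ erefl).
  have : (w n == Some r) = false by apply/eqP; congruence.
  by move=> ->; lia.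
have [h [m [hb hw hm bh hl]]] := IH b0 bw' rem0.
pose h' j := if j < n then h j else x.
pose m' j := if j == n then m0 else m j.
have ch j : j <= n -> carry h' m' j = carry h m j.
  elim: j => [|j IHj] //= lt_j; rewrite IHj ?(ltnW lt_j) // /h' lt_j /m'.
  by rewrite (_ : (j == n) = false) //; apply/eqP; lia.
have lh k r : k <= n -> labels h' k r = labels h k r.
  by move=> le_k; apply: eq_labels => j lt_j; rewrite /h' (_ : j < n) //; lia.
have hx : h' n = x by rewrite /h' ltnn.
have mx : m' n = m0 by rewrite /m' eqxx.
have ll r : labels h' n.+1 r + (b == Some r) = labels w n.+1 r.
  by rewrite !labelsS lh // hx -addnA Ew addnCA hl addnC.
exists h', m'; split=> //.
- by rewrite /= ch // hx mx hb Er.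
- move=> j; rewrite ltnS leq_eqVlt => /orP[/eqP->|lt_j]; first by rewrite ch // hx mx hb Er.
  rewrite ch ?(ltnW lt_j) // /h' lt_j /m' (_ : (j == n) = false) ?hw //.
  by apply/eqP; lia.
- move=> j; rewrite /m'; case: eqP => [->|ne /hm [lt_j h1 h2]].
    by rewrite ch // hx hb => /Em0[-> ->].
  by rewrite ch ?(ltnW lt_j) // /h' lt_j; split=> //; lia.
move=> j r; rewrite leq_eqVlt => /orP[/eqP->|lt_j]; last by rewrite !lh //; apply: bh.
have := ll r; have := ll r.+1; have := bw n.+1 r (leqnn _); have := rem r.
case: (b =P Some r) => [->|_] /=; last lia.
by move=> /(_ erefl); rewrite (inj_eq Some_inj); lia.
Qed.

(** Rows are peeled off the top with [row_surj]. The last box of [u] can be removed because [w] and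
    [u] end in the same shape and [u] is a ballot word. *)
Lemma growth_surj (w u : nat -> option nat) n N :
  ballot w N -> ballot u n -> (forall r, labels w N r = labels u n r) ->
  exists M : nat -> nat -> bool, [/\ forall i j, M i j -> i < n /\ j < N, partial_perm M,
    forall j, j < N -> hor M n j = w j & forall i, i < n -> ver M i N = u i].
Proof.
elim: n w => [|n IH] w bw bu Es.
  exists (fun _ _ => false); split=> // j lt_j.
  case Ew: (w j) => [r|] //; have := Es r; rewrite [RHS]/labels /=.
  move/eqP; rewrite /labels -leqn0 leqNgt -has_count => /hasP[]; exists j; rewrite ?mem_iota ?Ew //=.
have [] := @row_surj w N (u n) bw.
  move=> r eu; rewrite !Es !labelsS eu eqxx (inj_eq Some_inj).
  by have := bu n r (leqnSn _); lia.
move=> h [m [hb hw hm bh hl]].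
have [] := IH h bh.
- by move=> j r le_j; apply: bu; lia.
- by move=> r; have := hl r; rewrite Es labelsS; lia.
move=> M [sM MP hM vM].
pose M' i j := if i == n then m j else M i j.
have E i j : i < n -> M i j = M' i j by rewrite /M'; case: eqP => //; lia.
have hM' j : j < N -> hor M' n j = h j by move=> lt_j; rewrite -(growth_ext E) ?hM.
have cM' j : j <= N -> ver M' n j = carry h m j.
  elim: j => [|j IHj] // lt_j; rewrite verS IHj ?(ltnW lt_j) // hM' //.
  by rewrite /M' eqxx.
exists M'; split.
- move=> i j; rewrite /M'; case: eqP => [->|_] H; first by case: (hm _ H) => lt_j _ _; split.
  by case: (sM _ _ H); lia.
(* A point of the new row sits under an empty label, so its column has no earlier point; after it
   the carry is nonempty, so the row has no second point. *)
- have mN i j : M i j -> m j -> False.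
    move=> Mij /hm [lt_j hN _]; have := isSome_hor M n j; rewrite hM // hN => /esym/hasP[].
    by exists i; rewrite ?mem_iota //; case: (sM _ _ Mij).
  have mU j j' : m j -> m j' -> j <= j'.
    move=> mj mj'; have [_ _ cN] := hm _ mj; rewrite leqNgt; apply/negP => lt_j.
    by have := isSome_carry h m j; rewrite cN => /esym/hasP[]; exists j'; rewrite ?mem_iota.
  split=> [i j j'|i i' j]; rewrite /M'; case: eqP => [ei|ni].
  + by move=> mj mj'; apply/eqP; rewrite eqn_leq !mU.
  + by case: MP => + _; apply.
  + by case: eqP => [->|ni'] // mj /mN/(_ mj).
  + by case: eqP => [_ /mN H /H|ni'] //; case: MP => _; apply.
- move=> j lt_j; rewrite horS hM' // cM' ?(ltnW lt_j) // /M' eqxx; exact: hw.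
move=> i; rewrite ltnS leq_eqVlt => /orP[/eqP->|lt_i]; first by rewrite cM' // hb.
by rewrite -(growth_ext_ver E) // vM.
Qed.

(** * Involutions and tableau words *)

Definition involution_on (n : nat) (f : nat -> nat) :=
  forall i, i < n -> f i < n /\ f (f i) = i.

Definition graph_on (n : nat) (f : nat -> nat) : nat -> nat -> bool :=
  fun i j => (i < n) && (f i == j).

Definition tableau_word (n : nat) (f : nat -> nat) : seq nat :=
  mkseq (fun j => odflt 0 (hor (graph_on n f) n j)) n.

Definition letters (r : nat) (s : seq nat) := count (fun x => x == r) s.

Arguments letters : simpl never.

Definition row_ballot (s : seq nat) :=
  forall j r, letters r.+1 (take j s) <= letters r (take j s).

Lemma size_tableau_word n f : size (tableau_word n f) = n.
Proof. exact: size_mkseq. Qed.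

Lemma labels_take w s j r : (forall i, i < size s -> w i = Some (nth 0 s i)) ->
  labels w (minn j (size s)) r = letters r (take j s).
Proof.
move=> E; have -> : take j s = mkseq (nth 0 s) (minn j (size s)).
  apply: (@eq_from_nth _ 0); rewrite size_take_min ?size_mkseq // => i lt_i.
  by rewrite nth_mkseq // nth_take //; lia.
rewrite /letters /mkseq count_map /labels; apply: eq_in_count => i.
by rewrite mem_iota /= => lt_i; rewrite E //; lia.
Qed.

Section Involution.
Variables (n : nat) (f : nat -> nat).
Hypothesis fI : involution_on n f.

Lemma graph_sym i j : graph_on n f i j = graph_on n f j i.
Proof.
suff H i' j' : graph_on n f i' j' -> graph_on n f j' i' by apply/idP/idP; apply: H.
by case/andP=> lt_i /eqP <-; have [lt fK] := fI lt_i; rewrite /graph_on lt fK eqxx.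
Qed.

Lemma graph_partial_perm : partial_perm (graph_on n f).
Proof.
have H i j j' : graph_on n f i j -> graph_on n f i j' -> j = j'.
  by case/andP=> _ /eqP <- /andP[_ /eqP].
split=> // i i' j; rewrite graph_sym => h; rewrite graph_sym; exact: H h.
Qed.

Lemma hor_tableau_word j : j < n ->
  hor (graph_on n f) n j = Some (nth 0 (tableau_word n f) j).
Proof.
move=> lt_j; rewrite nth_mkseq //.
have : isSome (hor (graph_on n f) n j).
  rewrite isSome_hor; apply/hasP; have [lt fK] := fI lt_j.
  by exists (f j); rewrite ?mem_iota // /graph_on lt fK eqxx.
by case: (hor _ _ _).
Qed.

Lemma ver_tableau_word j : j < n ->
  ver (graph_on n f) j n = Some (nth 0 (tableau_word n f) j).
Proof. by move=> lt_j; rewrite -(hor_ver_tr graph_sym) ?hor_tableau_word. Qed.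

Lemma shape_tableau_word j r :
  shape (graph_on n f) n (minn j n) r = letters r (take j (tableau_word n f)).
Proof.
rewrite -[X in minn _ X](size_tableau_word n f); apply: labels_take.
by rewrite size_tableau_word; exact: hor_tableau_word.
Qed.

Lemma tableau_word_ballot : row_ballot (tableau_word n f).
Proof. by move=> j r; rewrite -!shape_tableau_word shape_partition //; exact: graph_partial_perm. Qed.

Lemma tableau_word_increasing4 :
  (3 < letters 0 (tableau_word n f)) <->
  exists a b c d, [/\ a < b < c, c < d < n, f a < f b < f c & f c < f d].
Proof.
rewrite -{1}[tableau_word n f](take_size) size_tableau_word -shape_tableau_word minnn.
rewrite -(chain_shape graph_partial_perm); split.
  move=> [d [fd [dn fdn /andP[_ /eqP ed] [c [fc [cd fcd /andP[_ /eqP ec]]]]]]].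
  move=> [b [fb [bc fbc /andP[_ /eqP eb] [a [fa [ab fab /andP[_ /eqP ea] _]]]]]].
  by exists a, b, c, d; subst; split; lia.
move=> [a [b [c [d [abc cdn fabc fcd]]]]].
have lt_d : d < n by lia.
have [lt_fd _] := fI lt_d.
rewrite /graph_on; exists d, (f d); split=> //; first by rewrite lt_d eqxx.
exists c, (f c); split; [lia|lia|by rewrite eqxx andbT; lia|].
exists b, (f b); split; [lia|lia|by rewrite eqxx andbT; lia|].
by exists a, (f a); split=> //; [lia|lia|rewrite eqxx andbT; lia].
Qed.

(** The diagram is symmetric, so the word can also be read on the vertical side, where [ver_descent]
    applies. Ascents of [f] thus become weak descents of the word. *)
Lemma tableau_word_descent i : i.+1 < n ->
  (nth 0 (tableau_word n f) i < nth 0 (tableau_word n f) i.+1) = (f i.+1 < f i).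
Proof.
move=> lt_i; have lt_i' : i < n by lia.
have [lt1 _] := fI lt_i'; have [lt2 _] := fI lt_i.
have [||a [b []]] := @ver_descent _ graph_partial_perm i (f i) (f i.+1) _ _ n lt1 lt2.
- by rewrite /graph_on lt_i' eqxx.
- by rewrite /graph_on lt_i eqxx.
by rewrite !ver_tableau_word // => -[->] [->].
Qed.

End Involution.

Lemma tableau_word_inj n f g : involution_on n f -> involution_on n g ->
  tableau_word n f = tableau_word n g -> forall i, i < n -> f i = g i.
Proof.
move=> fI gI E i lt_i; have [lt_fi _] := fI _ lt_i.
have := growth_inj (graph_partial_perm fI) (graph_partial_perm gI) (n := n) (N := n).
move=> /(_ _ _ i (f i) lt_i lt_fi); rewrite /graph_on lt_i eqxx /= => H.
apply/esym/eqP; rewrite -H //.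
- by move=> j lt_j; rewrite !hor_tableau_word // E.
- by move=> j lt_j; rewrite !ver_tableau_word // E.
Qed.

(** The diagram with [s] on both sides equals its transpose by uniqueness. All its boundary labels
    are boxes, so each row has a point and the points form an involution. *)
Lemma tableau_word_surj s : row_ballot s ->
  exists2 f, involution_on (size s) f & tableau_word (size s) f = s.
Proof.
move=> bs; pose n := size s; pose w j := Some (nth 0 s j).
have lw j r : j <= n -> labels w j r = letters r (take j s).
  by move=> le_j; rewrite -(@labels_take w s) //; congr labels; rewrite /n in le_j; lia.
have bw : ballot w n by move=> j r le_j; rewrite !lw.
have [M [sM MP hM vM]] := growth_surj bw bw (fun=> erefl).
have symM i j : M i j = M j i.
  have MT : partial_perm (fun i j => M j i).
    by case: MP => H1 H2; split=> [i' j' j''|i' i'' j']; [apply: H2|apply: H1].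
  suff H : forall i' j', i' < n -> j' < n -> M i' j' = M j' i'.
    by apply/idP/idP => h; have [? ?] := sM _ _ h; [rewrite -H|rewrite H].
  apply: (growth_inj MP MT) => [j'|i'] lt_j; first by rewrite hM // (@hor_ver_tr _ M) // vM.
  by rewrite vM // -(@hor_ver_tr M) // hM.
have dM i : i < n -> exists j, M i j.
  move=> lt_i; have := isSome_hor M n i; rewrite hM // => /esym/hasP[j _ Mj].
  by exists j; rewrite symM.
pose f i := find (M i) (iota 0 n).
have fM i : i < n -> M i (f i).
  move=> lt_i; have [j Mj] := dM i lt_i; have [_ lt_j] := sM _ _ Mj.
  have h : has (M i) (iota 0 n) by apply/hasP; exists j; rewrite ?mem_iota.
  by have := nth_find 0 h; rewrite nth_iota // -[X in _ < X](size_iota 0) -has_find.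
have fI : involution_on n f.
  move=> i lt_i; have Mi := fM i lt_i; have [_ lt_f] := sM _ _ Mi; split=> //.
  by case: MP => H _; apply: (H (f i)); [apply: fM|rewrite symM].
exists f => //; apply: (@eq_from_nth _ 0); rewrite size_tableau_word // => i lt_i.
apply: Some_inj; rewrite -hor_tableau_word // -[RHS]/(w i) -hM //.
apply: growth_ext (leqnn _) _ => a b lt_a; rewrite /graph_on lt_a /=.
apply/eqP/idP => [<-|Mab]; first exact: fM.
by case: MP => H _; apply: (H a); [apply: fM|].
Qed.

(** * Motzkin numbers *)

Fixpoint dyck_walks (l h : nat) : nat :=
  if l is l'.+1 then dyck_walks l' h.+1 + (if h is h'.+1 then dyck_walks l' h' else 0)
  else (h == 0).

Fixpoint motzkin_walks (n h : nat) : nat :=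
  if n is n'.+1 then
    motzkin_walks n' h.+1 + motzkin_walks n' h
    + (if h is h'.+1 then motzkin_walks n' h' else 0)
  else (h == 0).

Lemma dyck_walks_far l h : l < h -> dyck_walks l h = 0.
Proof.
elim: l h => [|l IH] [|h] //= lt_l; rewrite !IH //; lia.
Qed.

Lemma dyck_walks_odd l h : odd (l + h) -> dyck_walks l h = 0.
Proof.
elim: l h => [|l IH] [|h] //=; rewrite ?addn0 => o.
- by rewrite IH // addnS addn0 /= o.
- by rewrite !IH //; move: o; rewrite !addnS /= !negbK // => ->.
Qed.

(** The ballot numbers, cleared of denominators; [k] is the number of up steps. *)
Lemma dyck_walks_fact k h :
  dyck_walks (2 * k + h) h * ((k + h).+1`! * k`!) = h.+1 * (2 * k + h)`!.
Proof.
move: {2}(2 * k + h) (erefl (2 * k + h)) => l; elim: l k h => [|l IH] k h El.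
  by have [-> ->] : k = 0 /\ h = 0 by lia.
rewrite El /= mulnDl.
(* [E1] and [E2] treat a first step up and down; they add up since k(h + 2) + (k + h + 1)h = (h +
   1)(2k + h). *)
have E1 : dyck_walks l h.+1 * ((k + h).+1`! * k`!) = k * h.+2 * l`!.
  case: k El => [|k] El; first by rewrite dyck_walks_far //; lia.
  have := IH k h.+1; rewrite (_ : 2 * k + h.+1 = l); last lia.
  move=> /(_ erefl); rewrite -addSnnS [k.+1`!]factS => E.
  by rewrite -[RHS]mulnA -E; lia.
have E2 : (if h is h'.+1 then dyck_walks l h' else 0) * ((k + h).+1`! * k`!) =
    (k + h).+1 * h * l`!.
  case: h El {E1} => [|h] El; first by rewrite muln0.
  have := IH k h; rewrite (_ : 2 * k + h = l); last lia.
  move=> /(_ erefl) E; rewrite -[RHS]mulnA -E.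
  have -> : (k + h.+1).+1`! = (k + h.+1).+1 * (k + h).+1`! by rewrite factS addnS.
  by lia.
by rewrite E1 E2 factS -mulnDl mulnA; congr (_ * _); lia.
Qed.

(** Choose the positions of the [l] steps that are not level; they form a Dyck walk. *)
Lemma motzkin_walks_dyck n h m : n < m ->
  motzkin_walks n h = \sum_(l < m) 'C(n, l) * dyck_walks l h.
Proof.
elim: n h m => [|n IH] h [|m] // lt_n.
  by rewrite big_ord_recl big1 ?mul1n ?addn0.
have -> : motzkin_walks n.+1 h =
    motzkin_walks n h.+1 + motzkin_walks n h
    + (if h is h'.+1 then motzkin_walks n h' else 0) by [].
rewrite big_ord_recl bin0 (eq_bigr (fun i : 'I_m =>
  'C(n, i.+1) * dyck_walks i.+1 h + ('C(n, i) * dyck_walks i h.+1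
   + 'C(n, i) * (if h is h'.+1 then dyck_walks i h' else 0)))); last first.
  by move=> i _; rewrite -mulnDr lift0 binS mulnDl.
rewrite !big_split /= -(IH h.+1) // addnA.
have -> : 1 * (h == 0) + \sum_(i < m) 'C(n, i.+1) * dyck_walks i.+1 h = motzkin_walks n h.
  by rewrite (IH h m.+1) ?big_ord_recl ?bin0 //; lia.
rewrite addnA [_ + motzkin_walks n h]addnC; congr (_ + _).
case: h => [|h]; first by rewrite big1 // => i _; rewrite muln0.
by rewrite -IH.
Qed.

Lemma sum_even_odd (F : nat -> nat) m :
  \sum_(l < 2 * m) F l = \sum_(k < m) (F (2 * k) + F (2 * k).+1).
Proof.
elim: m => [|m IH]; first by rewrite muln0 !big_ord0.
by rewrite mulnS add2n !big_ord_recr /= IH addnA.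
Qed.

Lemma motzkin_walks0 n : motzkin_walks n 0 = motzkin n.
Proof.
(* An even bound above [n], so that lengths pair up; the odd ones contribute 0. *)
rewrite (@motzkin_walks_dyck n 0 (2 * (n %/ 2).+1)); last first.
  by have := divn_eq n 2; have := ltn_pmod n (isT : 0 < 2); lia.
rewrite (sum_even_odd (fun l => 'C(n, l) * dyck_walks l 0)) /motzkin big_mkord.
apply: eq_bigr => -[k lt_k] _; rewrite [nat_of_ord _]/=.
rewrite (@dyck_walks_odd (2 * k).+1 0) ?muln0; last by rewrite addn0 /= oddM.
have le_k : 2 * k <= n by have := divn_eq n 2; lia.
rewrite addn0 -(bin_fact le_k).
have := dyck_walks_fact k 0; rewrite !addn0 mul1n => <-.
rewrite [X in _ = X %/ _](_ : _ = 'C(n, 2 * k) * dyck_walks (2 * k) 0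
  * (k`! * (k.+1)`! * (n - 2 * k)`!)); last lia.
by rewrite mulnK // !muln_gt0 !fact_gt0.
Qed.

(** Walks with free endpoint on the dominant weights of SL_3. With x = c1 - c2 and y = c2 - c3 for
    column heights c1, c2, c3, the steps add a box to columns 1 and 2, 1 and 3, or 2 and 3. *)
Fixpoint chamber_walks (n x y : nat) : nat :=
  if n is n'.+1 then
    chamber_walks n' x y.+1
    + (if y is y'.+1 then chamber_walks n' x.+1 y' else 0)
    + (if x is x'.+1 then chamber_walks n' x' y else 0)
  else 1.

(** For a = x + 1 and b = y + 1 the numbers i + j are the highest weights in the restriction to SL_2
    of the SL_3-representation of highest weight (x, y). *)
Definition box_sum (T : nat -> nat) (a b : nat) := \sum_(i < a) \sum_(j < b) T (i + j).

Lemma box_sumS T a b : box_sum T a.+1 b = \sum_(j < b) T j + box_sum (T \o succn) a b.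
Proof. by rewrite /box_sum big_ord_recl. Qed.

(* Branching from SL_3 to SL_2: each irreducible representation of SL_3 has a
   one-dimensional space of SL_2-invariants. *)
Lemma chamber_walks_motzkin n x y :
  chamber_walks n x y = box_sum (motzkin_walks n) x.+1 y.+1.
Proof.
elim: n x y => [|n IH] x y.
  rewrite /box_sum big_ord_recl [X in _ + X]big1 => [|i _]; last by rewrite big1.
  by rewrite big_ord_recl big1.
set T := motzkin_walks n.
have shift a b : box_sum (T \o succn) a b = \sum_(i < a) \sum_(j < b) T (i + j.+1).
  by apply: eq_bigr => i _; apply: eq_bigr => j _; rewrite /= addnS.
pose T' h := if h is h'.+1 then T h' else 0.
have -> : box_sum (motzkin_walks n.+1) x.+1 y.+1 =
    box_sum (T \o succn) x.+1 y.+1 + box_sum T x.+1 y.+1 + box_sum T' x.+1 y.+1.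
  by rewrite -!big_split; apply: eq_bigr => i _; rewrite -!big_split.
have T'E b : \sum_(j < b.+1) T' j = \sum_(j < b) T j by rewrite big_ord_recl add0n.
have boxSr F a b : box_sum F a b.+1 = \sum_(i < a) F i + box_sum (F \o succn) a b.
  rewrite /box_sum -big_split; apply: eq_bigr => i _; rewrite big_ord_recl addn0 /=.
  by congr addn; apply: eq_bigr => j _; rewrite /= addnS.
have boxr F a b : box_sum F a b.+1 = box_sum F a b + \sum_(i < a) F (i + b).
  by rewrite /box_sum -big_split; apply: eq_bigr => i _; rewrite big_ord_recr.
rewrite /= !IH -/T.
have -> : (if y is y'.+1 then chamber_walks n x.+1 y' else 0) = box_sum T x.+2 y.
  by case: y => [|y]; [rewrite /box_sum big1 // => i _; rewrite big_ord0|rewrite IH].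
have -> : (if x is x'.+1 then chamber_walks n x' y else 0) = box_sum T x y.+1.
  by case: x => [|x]; [rewrite /box_sum big_ord0|rewrite IH].
(* Splitting off boundary rows and columns brings the boxes to common sizes, and the identity
   becomes linear. *)
rewrite (boxr T x.+1 y.+1) (boxr (T \o succn) x.+1 y).
rewrite (box_sumS T' x) T'E (box_sumS T x.+1).
have -> : box_sum (T' \o succn) x y.+1 = box_sum T x y.+1 by [].
have -> : \sum_(i < x.+1) (T \o succn) (i + y) = \sum_(i < x.+1) T (i + y.+1).
  by apply: eq_bigr => i _; rewrite /= addnS.
lia.
Qed.

Lemma chamber_walks0 n : chamber_walks n 0 0 = motzkin n.
Proof. by rewrite chamber_walks_motzkin /box_sum !big_ord1 motzkin_walks0. Qed.

(** * Words with three columns *)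

(* The Young diagram with columns of heights [c1 >= c2 >= c3] grows by one box
   per letter, the letter being the row of that box. *)
Fixpoint three_columns (c1 c2 c3 : nat) (s : seq nat) : bool :=
  if s is r :: s' then
    [|| (r == c1) && three_columns c1.+1 c2 c3 s',
        [&& c2 < c1, r == c2 & three_columns c1 c2.+1 c3 s'] |
        [&& c3 < c2, r == c3 & three_columns c1 c2 c3.+1 s']]
  else true.

Lemma letters_cons r x s : letters r (x :: s) = (x == r) + letters r s.
Proof. by []. Qed.

(** [row r] is the length of row [r] of the diagram. A row can be extended exactly if it is the
    first free row of some column, the bound 3 supplying an empty column when the letter is 0. *)
Lemma three_columnsP c1 c2 c3 (s : seq nat) : c3 <= c2 <= c1 ->
  let row r := (r < c1) + (r < c2) + (r < c3) in
  (row 0 + letters 0 s <= 3 /\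
   forall j r, row r.+1 + letters r.+1 (take j s) <= row r + letters r (take j s))
  <-> three_columns c1 c2 c3 s.
Proof.
elim: s c1 c2 c3 => [|x s IH] c1 c2 c3 le_c row; rewrite /row {row}.
  by split=> // _; split=> [|j r]; rewrite /letters /=; lia.
rewrite letters_cons /=; split=> [[H0 Hb]|].
  have Hx : x = c1 \/ c2 < c1 /\ x = c2 \/ c3 < c2 /\ x = c3.
    case: x H0 Hb => [|x] H0 Hb; first by move: H0 => /=; lia.
    by have := Hb 1 x; rewrite take_cons take0 !letters_cons /letters /=; lia.
  have Hb' j r : ((r.+1 < c1) + (r.+1 < c2) + (r.+1 < c3)) + ((x == r.+1) + letters r.+1 (take j s)) <=
      ((r < c1) + (r < c2) + (r < c3)) + ((x == r) + letters r (take j s)).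
    by have := Hb j.+1 r; rewrite /= !letters_cons.
  case: Hx => [e|[[lt e]|[lt e]]].
  - apply/orP; left; rewrite e eqxx; apply/IH; first lia.
    by split=> [|j r]; [lia|have := Hb' j r; lia].
  - apply/orP; right; apply/orP; left; rewrite e eqxx lt; apply/IH; first lia.
    by split=> [|j r]; [lia|have := Hb' j r; lia].
  - apply/orP; right; apply/orP; right; rewrite e eqxx lt; apply/IH; first lia.
    by split=> [|j r]; [lia|have := Hb' j r; lia].
case/or3P=> [/andP[/eqP e]|/and3P[lt /eqP e]|/and3P[lt /eqP e]] /IH [|H0 Hb]; try lia.
- split=> [|[|j] r]; [lia|rewrite take0 /letters /=; lia|rewrite /= !letters_cons; have := Hb j r; lia].
- split=> [|[|j] r]; [lia|rewrite take0 /letters /=; lia|rewrite /= !letters_cons; have := Hb j r; lia].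
- split=> [|[|j] r]; [lia|rewrite take0 /letters /=; lia|rewrite /= !letters_cons; have := Hb j r; lia].
Qed.

(* [p] pairs of letters in the rows of two distinct columns, from left to right,
   followed by one strictly ascending pair if [b] holds. *)
Fixpoint paired (b : bool) (p : nat) (s : seq nat) : bool :=
  match p, s with
  | 0, [::] => ~~ b
  | 0, [:: x; y] => b && (x < y)
  | p'.+1, x :: y :: s' => (y <= x) && paired b p' s'
  | _, _ => false
  end.

(** The index with [i.+1 = 2 * p], between the last descending pair and the final one, is left free:
    there a point will have been deleted. *)
Definition alternating_pairs (p : nat) (s : seq nat) :=
  forall i, i.+1 < size s -> i.+1 <> 2 * p ->
    (nth 0 s i.+1 <= nth 0 s i) = ~~ odd i && (i < 2 * p).

(* Having three columns forces the strict ascent between consecutive pairs. *)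
Lemma paired_alternating b p s c1 c2 c3 : c3 <= c2 <= c1 ->
  three_columns c1 c2 c3 s ->
  paired b p s <-> size s = 2 * (p + b) /\ alternating_pairs p s.
Proof.
elim: p s c1 c2 c3 => [|p IH] s c1 c2 c3 le_c.
  case: s => [|x [|y [|z s]]] cw.
  - split=> [|[]]; last by case: b.
    by case: b => // _; split.
  - by split=> // -[] /=; lia.
  - split=> [/andP[-> lt]|[es A]].
      split=> // -[|i] //= _ _; apply/negbTE; lia.
    have := A 0 isT; rewrite /= => /(_ (fun e => ltac:(lia))) /negbT.
    by move: es; case: b => //= _; lia.
  - by split=> // -[] /=; case: b => //=; lia.
case: s => [|x [|y s]] cw; try by split=> // -[] /=; lia.
have [d1 [d2 [d3 [le_d cw' Hd]]]] : exists d1 d2 d3, [/\ d3 <= d2 <= d1, three_columns d1 d2 d3 s &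
     y <= x -> y < d2].
  move: cw => /=.
  case/or3P=> [/andP[/eqP e]|/and3P[lt /eqP e]|/and3P[lt /eqP e]];
  case/or3P=> [/andP[/eqP e']|/and3P[lt' /eqP e']|/and3P[lt' /eqP e']] cw';
  [exists c1.+2, c2, c3| exists c1.+1, c2.+1, c3| exists c1.+1, c2, c3.+1| exists c1.+1, c2.+1, c3
  |exists c1, c2.+2, c3|exists c1, c2.+1, c3.+1|exists c1.+1, c2, c3.+1|exists c1, c2.+1, c3.+1|exists c1, c2, c3.+2];
  split=> //; lia.
have IHs := IH s _ _ _ le_d cw'; rewrite /=; split.
  case/andP=> le_yx /IHs[es A]; split; first by rewrite es; lia.
  move=> [|[|i]] /=.
  - by rewrite le_yx => _ _; lia.
  - move=> lt_s ne2; case: p es A ne2 {IH IHs} => [|p] es A ne2; first by lia.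
    have lt_y := Hd le_yx.
    case: s cw' es A lt_s {cw} => [|x' [|y' s]] //= cw' es A _; first by move: es; case: (b); lia.
    have := A 0 isT; rewrite /= => /(_ (fun e => ltac:(lia))) le_y'.
    have {}le_y' : y' <= x' by rewrite le_y'; lia.
    apply/negbTE; rewrite -ltnNge.
    (* A next letter in the first two columns is at least [d2], hence above [y]; after one in the
       third column no weak descent can follow. *)
    case/or3P: cw' => [/andP[/eqP e _]|/and3P[_ /eqP e _]|/and3P[lt /eqP e cw']]; try lia.
  - move=> lt_s ne; rewrite A ?negbK; [|lia|lia]; congr andb; lia.
case=> es A; have le_yx : y <= x.
  have := A 0 isT; rewrite /= => ->; lia.
rewrite le_yx; apply/IHs; split; first by move: es; rewrite /=; lia.
by move=> i lt_i ne; have := A i.+2; rewrite /= => ->; [rewrite negbK; congr andb|..]; lia.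
Qed.

(** * Enumeration of the paired words *)

Definition tails (b : bool) (c1 c2 c3 : nat) : seq (seq nat) :=
  if b then
    [:: [:: c1; c1.+1]]
    ++ (if c2 < c1 then [:: [:: c2; c1]] else [::])
    ++ (if c2.+1 < c1 then [:: [:: c2; c2.+1]] else [::])
    ++ (if c3 < c2 then [:: [:: c3; c1]] else [::])
    ++ (if (c3 < c2) && (c2 < c1) then [:: [:: c3; c2]] else [::])
    ++ (if c3.+1 < c2 then [:: [:: c3; c3.+1]] else [::])
  else [:: [::]].

(** Each pair chooses two of the three columns. The guards, here and in [tails], make the boxes
    addable and keep columns of equal height from producing a word twice. *)
Fixpoint paired_words (b : bool) (p c1 c2 c3 : nat) : seq (seq nat) :=
  if p is p'.+1 then
    [seq c1 :: c2 :: s | s <- paired_words b p' c1.+1 c2.+1 c3]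
    ++ (if c3 < c2 then [seq c1 :: c3 :: s | s <- paired_words b p' c1.+1 c2 c3.+1] else [::])
    ++ (if c2 < c1 then [seq c2 :: c3 :: s | s <- paired_words b p' c1 c2.+1 c3.+1] else [::])
  else tails b c1 c2 c3.

Lemma mem_map_cons2 (x y x' y' : nat) s (l : seq (seq nat)) :
  (x :: y :: s \in [seq x' :: y' :: t | t <- l]) = [&& x == x', y == y' & s \in l].
Proof.
apply/mapP/and3P => [[t lt [-> -> ->]]|[/eqP-> /eqP-> ls]]; first by split.
by exists s.
Qed.

Lemma short_mem_map_cons2 (x y : nat) s (l : seq (seq nat)) :
  size s < 2 -> (s \in [seq x :: y :: t | t <- l]) = false.
Proof. by move=> lt_s; apply/mapP => -[t _ e]; move: lt_s; rewrite e. Qed.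

Lemma mem_if (c : bool) (T : eqType) (x : T) l :
  (x \in if c then l else [::]) = c && (x \in l).
Proof. by case: c. Qed.

Lemma mem_paired_words b p c1 c2 c3 s : c3 <= c2 <= c1 ->
  (s \in paired_words b p c1 c2 c3) = three_columns c1 c2 c3 s && paired b p s.
Proof.
elim: p c1 c2 c3 s => [|p IH] c1 c2 c3 s le_c.
  rewrite /= /tails; case: b => /=; last first.
    by rewrite inE; case: s => [|x [|y [|z s]]] //=; rewrite ?andbF.
  rewrite inE !mem_cat !mem_if !inE.
  case: s => [|x [|y [|z s]]]; rewrite ?andbF //= ?eqseq_cons ?eqE /= ?andbF ?orbF //; try by apply/negbTE; lia.
  by rewrite ?andbT; apply/idP/idP; lia.
rewrite /= !mem_cat !mem_if.
case: s => [|x [|y s]]; first by rewrite !short_mem_map_cons2 ?andbF.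
  by rewrite !short_mem_map_cons2 ?andbF.
rewrite !mem_map_cons2 IH; last lia.
rewrite /=.
have -> : (c3 < c2) && [&& x == c1, y == c3 & s \in paired_words b p c1.+1 c2 c3.+1] =
   [&& c3 < c2, x == c1, y == c3, three_columns c1.+1 c2 c3.+1 s & paired b p s].
  by case: (ltnP c3 c2) => //= lt; rewrite IH //; lia.
have -> : (c2 < c1) && [&& x == c2, y == c3 & s \in paired_words b p c1 c2.+1 c3.+1] =
   [&& c2 < c1, x == c2, y == c3, three_columns c1 c2.+1 c3.+1 s & paired b p s].
  by case: (ltnP c2 c1) => //= lt; rewrite IH //; lia.
case: (paired b p s); last by rewrite !andbF.
by rewrite !andbT; apply/idP/idP; lia.
Qed.

Lemma uniq_map_cons2 (x y : nat) (l : seq (seq nat)) :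
  uniq [seq x :: y :: s | s <- l] = uniq l.
Proof. by rewrite map_inj_uniq // => s t []. Qed.

Lemma uniq_paired_words b p c1 c2 c3 : c3 <= c2 <= c1 -> uniq (paired_words b p c1 c2 c3).
Proof.
elim: p c1 c2 c3 => [|p IH] c1 c2 c3 le_c.
  rewrite /= /tails; case: b => //=.
  case: (ltnP c2 c1) => ?; case: (ltnP c2.+1 c1) => ?; case: (ltnP c3 c2) => ?;
  case: (ltnP c3.+1 c2) => ?; rewrite //= !inE !eqseq_cons !eqE /=; lia.
rewrite /= cat_uniq; apply/and3P; split.
- by rewrite uniq_map_cons2 IH //; lia.
- rewrite has_cat negb_or; apply/andP; split; case: ifP => // lt; apply/hasPn => _ /mapP[s _ ->];
  by rewrite mem_map_cons2; apply/negP; lia.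
rewrite cat_uniq; apply/and3P; split.
- by case: ifP => // lt; rewrite uniq_map_cons2 IH //; lia.
- case: (ltnP c2 c1) => // lt; apply/hasPn => _ /mapP[s _ ->].
  by rewrite mem_if mem_map_cons2; apply/negP; lia.
- by case: ifP => // lt; rewrite uniq_map_cons2 IH //; lia.
Qed.

Lemma size_paired_words_false p c1 c2 c3 x y : c2 = c3 + y -> c1 = c2 + x ->
  size (paired_words false p c1 c2 c3) = chamber_walks p x y.
Proof.
elim: p c1 c2 c3 x y => [|p IH] c1 c2 c3 x y e2 e1 //=.
rewrite !size_cat size_map addnA; congr (_ + _ + _); first by apply: IH; lia.
- case: y e2 => [|y] e2; first by rewrite (_ : c3 < c2 = false) //; lia.
  by rewrite (_ : c3 < c2) ?size_map; [apply: IH|]; lia.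
- case: x e1 => [|x] e1; first by rewrite (_ : c2 < c1 = false) //; lia.
  by rewrite (_ : c2 < c1) ?size_map; [apply: IH|]; lia.
Qed.

(** Both sides obey the recursion of the walks, so only p = 0, the list [tails], needs checking. The
    addition stands for a difference of walk numbers. *)
Lemma size_paired_words_true p c1 c2 c3 x y : c2 = c3 + y -> c1 = c2 + x ->
  size (paired_words true p c1 c2 c3) + chamber_walks p.+1 x y = chamber_walks p.+2 x y.
Proof.
elim: p c1 c2 c3 x y => [|p IH] c1 c2 c3 x y e2 e1.
  rewrite [paired_words _ _ _ _ _]/= /tails.
  rewrite (_ : c2 < c1 = (0 < x)); last lia.
  rewrite (_ : c2.+1 < c1 = (1 < x)); last lia.
  rewrite (_ : c3 < c2 = (0 < y)); last lia.
  rewrite (_ : c3.+1 < c2 = (1 < y)); last lia.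
  by case: x e1 => [|[|x]] _; case: y e2 => [|[|y]] _.
have H n u v : chamber_walks n.+1 u v = chamber_walks n u v.+1
    + (if v is v'.+1 then chamber_walks n u.+1 v' else 0)
    + (if u is u'.+1 then chamber_walks n u' v else 0) by [].
rewrite [paired_words _ _ _ _ _]/= !size_cat size_map (H p.+1) (H p.+2).
have E1 := IH c1.+1 c2.+1 c3 x y.+1.
have E2 : size (if c3 < c2 then [seq [:: c1, c3 & s] | s <- paired_words true p c1.+1 c2 c3.+1] else [::])
   + (if y is v'.+1 then chamber_walks p.+1 x.+1 v' else 0) = if y is v'.+1 then chamber_walks p.+2 x.+1 v' else 0.
  case: y e2 {E1} => [|y] e2; first by rewrite (_ : c3 < c2 = false) //; lia.
  by rewrite (_ : c3 < c2) ?size_map; [apply: IH|]; lia.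
have E3 : size (if c2 < c1 then [seq [:: c2, c3 & s] | s <- paired_words true p c1 c2.+1 c3.+1] else [::])
   + (if x is v'.+1 then chamber_walks p.+1 v' y else 0) = if x is v'.+1 then chamber_walks p.+2 v' y else 0.
  case: x e1 {E1 E2} => [|x] e1; first by rewrite (_ : c2 < c1 = false) //; lia.
  by rewrite (_ : c2 < c1) ?size_map; [apply: IH|]; lia.
by rewrite -E2 -E3 -E1; lia.
Qed.

(** * Rearranging the inner points *)

Section Flip.
Variable N : nat.
Implicit Types (p q s : 'S_N) (x y : nat) (i j a b : 'I_N).

Definition has1234 p := exists a b c d : 'I_N,
  [/\ a < b < c, c < d, p a < p b < p c & p c < p d].

Definition has2134 p := exists a b c d : 'I_N,
  [/\ a < b < c, c < d, p b < p a < p c & p c < p d].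

Definition below_ascent p x y := 
  [exists a : 'I_N, exists b : 'I_N, [&& x < a, a < b, y < p a & p a < p b]].

Definition inner p i := below_ascent p i (p i).

(* [q] arises from [p] by rearranging the inner points of [p] within the
   region [below_ascent p]. *)
Definition flip_rel p q := [forall i, if inner p i then below_ascent p i (q i) else q i == p i].

Lemma below_ascentP p x y :
  reflect (exists a b : 'I_N, [/\ x < a, a < b, y < p a & p a < p b]) (below_ascent p x y).
Proof.
apply: (iffP existsP) => [[a /existsP[b /and4P[]]]|[a [b [? ? ? ?]]]]; first by exists a, b.
by exists a; apply/existsP; exists b; apply/and4P.
Qed.

Lemma below_ascent_down p x y x' y' :
  below_ascent p x y -> x' <= x -> y' <= y -> below_ascent p x' y'.
Proof.
case/below_ascentP=> a [b [? ? ? ?]] ? ?; apply/below_ascentP.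
by exists a, b; split=> //; lia.
Qed.

(** If the first point of the ascent is inner, move to an ascent to its upper right; once it is
    outer, so is the second. Hence the outer points alone determine the region. *)
Lemma below_ascent_outer p x y : below_ascent p x y ->
  exists a b : 'I_N, [/\ x < a, a < b, y < p a & p a < p b] /\ (~~ inner p a /\ ~~ inner p b).
Proof.
move: {2}(N - x) (leqnn (N - x)) => m; elim: m x y => [|m IH] x y le_m.
  by case/below_ascentP=> a [b [? ? ? ?]]; have := ltn_ord a; lia.
case/below_ascentP=> a [b [xa ab ya pab]].
case Ea: (inner p a).
  have [|c [d [[? ? ? ?] H]]] := IH a (p a) _ Ea; first by have := ltn_ord a; lia.
  by exists c, d; split=> //; split=> //; lia.
exists a, b; split=> //; rewrite Ea; split=> //; apply: contraFN Ea => h.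
by apply: below_ascent_down h _ _; lia.
Qed.

Lemma flip_relP p q : reflect
  ((forall i, inner p i -> below_ascent p i (q i)) /\ (forall i, ~~ inner p i -> q i = p i))
  (flip_rel p q).
Proof.
apply: (iffP forallP) => [H|[H1 H2] i].
  by split=> i; have := H i; case: ifP => // _ /eqP.
by case: ifP => [/H1//|/negbT/H2->].
Qed.

Lemma flip_rel_refl p : flip_rel p p.
Proof. by apply/flip_relP. Qed.

(** Outer points do not move and witness the region; moved points stay inside it and so cannot
    enlarge it. *)
Lemma below_ascent_flip p q x y : flip_rel p q -> below_ascent q x y = below_ascent p x y.
Proof.
case/flip_relP=> H1 H2; apply/idP/idP; last first.
  case/below_ascent_outer=> a [b [[? ? ? ?] [/H2 ea /H2 eb]]].
  by apply/below_ascentP; exists a, b; rewrite ea eb.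
case/below_ascentP=> a [b [xa ab ya qab]].
case Ea: (inner p a); first by apply: (below_ascent_down (H1 _ Ea)); lia.
case Eb: (inner p b); first by apply: (below_ascent_down (H1 _ Eb)); lia.
apply/below_ascentP; exists a, b.
by rewrite -(H2 a) ?Ea // -(H2 b) ?Eb.
Qed.

Lemma inner_flip p q i : flip_rel p q -> inner q i = inner p i.
Proof.
move=> R; rewrite /inner (below_ascent_flip _ _ R); have [H1 H2] := flip_relP _ _ R.
case E: (inner p i); first by rewrite H1.
by rewrite H2 ?E //; exact: E.
Qed.

Lemma flip_rel_trans p q s : flip_rel p q -> flip_rel q s -> flip_rel p s.
Proof.
move=> R R'; have [H1 H2] := flip_relP _ _ R; have [H3 H4] := flip_relP _ _ R'.
apply/flip_relP; split=> i Hi; first by rewrite -(below_ascent_flip _ _ R) H3 // (inner_flip _ R).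
by rewrite H4 ?H2 // (inner_flip _ R).
Qed.

Lemma has1234P p : has1234 p <-> exists a b : 'I_N, [/\ a < b, p a < p b & inner p b].
Proof.
split=> [[a [b [c [d [? ? ? ?]]]]]|[a [b [ab pab /below_ascentP[c [d [? ? ? ?]]]]]]].
  by exists a, b; split; [lia|lia|apply/below_ascentP; exists c, d; split; lia].
by exists a, b, c, d; split; lia.
Qed.

(** The corner in column [b] and row [p a] lies in the region, so both points are inner; for 1234 it
    suffices that the upper point is. *)
Lemma has2134P p : has2134 p <-> exists a b : 'I_N, [/\ a < b, p b < p a & below_ascent p b (p a)].
Proof.
split=> [[a [b [c [d [? ? ? ?]]]]]|[a [b [ab pab /below_ascentP[c [d [? ? ? ?]]]]]]].
  by exists a, b; split; [lia|lia|apply/below_ascentP; exists c, d; split; lia].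
by exists a, b, c, d; split; lia.
Qed.

Lemma flip_rel_swap p q a b : flip_rel p q -> inner p a -> inner p b ->
  below_ascent p a (q b) -> below_ascent p b (q a) -> flip_rel p (tperm a b * q)%g.
Proof.
move=> R ia ib Hab Hba; have [H1 H2] := flip_relP _ _ R.
apply/flip_relP; split=> i; rewrite permM; case: tpermP => [->|->|/eqP na /eqP nb] //; rewrite ?ia ?ib //.
- exact: H1.
- exact: H2.
Qed.

Definition weight p := \sum_(i < N) i * p i.

(** The swap changes the weight by (b - a)(q a - q b), written without subtraction. *)
Lemma weight_swap q a b : a != b ->
  weight (tperm a b * q)%g + (a * q a + b * q b) = weight q + (a * q b + b * q a).
Proof.
move=> ab; have D (F : 'I_N -> nat) :
    \sum_(i < N) F i = F a + (F b + \sum_(i < N | (i != a) && (i != b)) F i).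
  by rewrite (bigD1 a) //= (bigD1 b) // eq_sym.
rewrite /weight (D (fun i : 'I_N => i * q i)) D !permM tpermL tpermR.
rewrite (eq_bigr (fun i : 'I_N => i * q i)) => [|i /andP[ia ib]]; last by rewrite permM tpermD // eq_sym.
by move: (bigop _ _ _) (nat_of_ord (q a)) (nat_of_ord (q b)) => S u v; lia.
Qed.

(* Sorting an inner pair against the order of the forbidden pattern changes the
   weight monotonically, so an extremal rearrangement avoids the pattern. *)
Definition flip1234 p := [arg min_(q < p | flip_rel p q) weight q].

Lemma flip1234P p : flip_rel p (flip1234 p) /\ ~ has1234 (flip1234 p).
Proof.
rewrite /flip1234; case: (@arg_minnP _ p (flip_rel p) weight (flip_rel_refl p)) => q R qmin; split=> //.
case/has1234P=> a [b [ab qab]]; rewrite (inner_flip _ R) => ib.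
have [H1 _] := flip_relP _ _ R; have lb := H1 _ ib.
have ia : inner p a.
  rewrite -(inner_flip _ R) /inner (below_ascent_flip _ _ R); apply: below_ascent_down lb _ _; lia.
have := qmin _ (flip_rel_swap R ia ib (below_ascent_down lb (ltnW ab) (leqnn _))
  (below_ascent_down lb (leqnn _) (ltnW qab))).
have ne : a != b by apply: contraTneq ab => ->; rewrite ltnn.
have := weight_swap q ne; nia.
Qed.

Definition flip2134 p := [arg max_(q > p | flip_rel p q) weight q].

Lemma flip2134P p : flip_rel p (flip2134 p) /\ ~ has2134 (flip2134 p).
Proof.
rewrite /flip2134; case: (@arg_maxnP _ p (flip_rel p) weight (flip_rel_refl p)) => q R qmin.
split=> //; case/has2134P=> a [b [ab qab]]; rewrite (below_ascent_flip _ _ R) => lb.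
have ib : inner p b.
  rewrite -(inner_flip _ R) /inner (below_ascent_flip _ _ R); apply: below_ascent_down lb _ _; lia.
have ia : inner p a.
  rewrite -(inner_flip _ R) /inner (below_ascent_flip _ _ R); apply: below_ascent_down lb _ _; lia.
have := qmin _ (flip_rel_swap R ia ib (below_ascent_down lb (ltnW ab) (ltnW qab)) lb).
have ne : a != b by apply: contraTneq ab => ->; rewrite ltnn.
have := weight_swap q ne; nia.
Qed.

Lemma last_difference q s : q != s ->
  exists i, q i != s i /\ forall j, i < j -> q j = s j.
Proof.
move=> ne; have [i0 Hi0] : exists i, q i != s i.
  apply/existsP; rewrite -negb_forall; apply: contra ne => /forallP H.
  by apply/eqP/permP => i; apply/eqP.
case: (@arg_minnP _ i0 (fun i => q i != s i) (fun i => N - i) Hi0) => i Hi imax.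
exists i; split=> // j ij; apply/eqP; apply: contraTT ij => /imax; have := ltn_ord j; lia.
Qed.

Lemma last_difference_swap q s i : (forall j, i < j -> q j = s j) -> q i != s i ->
  exists2 k : 'I_N, k < i & s k = q i.
Proof.
move=> E ne; exists (s^-1 (q i))%g; last by rewrite permKV.
rewrite ltn_neqAle leqNgt; apply/andP; split.
  by apply: contra ne => /eqP/val_inj H; rewrite -{2}H permKV.
apply/negP => /[dup] lt /E; rewrite permKV => /perm_inj H.
by move: lt; rewrite H ltnn.
Qed.

(** At the last difference [i], say q i < s i, the value [q i] occurs in [s] before [i]. Since [i]
    is inner, this gives 1234 in [s]. *)
Lemma flip1234_uniq p q s : flip_rel p q -> flip_rel p s -> ~ has1234 q -> ~ has1234 s -> q = s.
Proof.
move=> Rq Rs Aq As; apply/eqP; apply: contraT => /last_difference [i [ne E]]; exfalso.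
wlog lt : q s Rq Rs Aq As ne E / q i < s i.
  move=> H; case: (ltngtP (q i) (s i)) => [|lt|/val_inj e]; first exact: (H q s).
    by apply: (H s q) => // [|j /E]; rewrite eq_sym in ne *.
  by rewrite e eqxx in ne.
have [k ki sk] := last_difference_swap E ne.
apply: As; apply/has1234P; exists k, i; rewrite sk; split=> //.
rewrite (inner_flip _ Rs); apply: contraT => ni.
have [_ H2] := flip_relP _ _ Rq; have [_ H4] := flip_relP _ _ Rs.
by rewrite H2 // H4 // eqxx in ne.
Qed.

(** As for 1234, but with s i < q i: the earlier occurrence of [q i] in [s] forms a descent with
    [i], whose corner (i, q i) is in the region because [q] is a rearrangement. *)
Lemma flip2134_uniq p q s : flip_rel p q -> flip_rel p s -> ~ has2134 q -> ~ has2134 s -> q = s.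
Proof.
move=> Rq Rs Aq As; apply/eqP; apply: contraT => /last_difference [i [ne E]]; exfalso.
wlog lt : q s Rq Rs Aq As ne E / s i < q i.
  move=> H; case: (ltngtP (q i) (s i)) => [lt||/val_inj e]; last by rewrite e eqxx in ne.
    by apply: (H s q) => // [|j /E]; rewrite eq_sym in ne *.
  exact: (H q s).
have [k ki sk] := last_difference_swap E ne.
apply: As; apply/has2134P; exists k, i; rewrite sk; split=> //.
rewrite (below_ascent_flip _ _ Rs).
have [H1 H2] := flip_relP _ _ Rq; have [_ H4] := flip_relP _ _ Rs; apply: H1.
by apply: contraT => ni; rewrite H2 // H4 // eqxx in ne.
Qed.

Lemma has1234V p : has1234 p -> has1234 (p^-1)%g.
Proof.
by case=> a [b [c [d [? ? ? ?]]]]; exists (p a), (p b), (p c), (p d); rewrite !permK; split; lia.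
Qed.

Lemma has2134V p : has2134 p -> has2134 (p^-1)%g.
Proof.
by case=> a [b [c [d [? ? ? ?]]]]; exists (p b), (p a), (p c), (p d); rewrite !permK; split; lia.
Qed.

Lemma below_ascent_sym p x y : (p^-1)%g = p -> below_ascent p x y -> below_ascent p y x.
Proof.
move=> pV /below_ascentP[a [b [? ? ? ?]]]; apply/below_ascentP; exists (p a), (p b).
have pK : forall i, p (p i) = i by move=> i; rewrite -{1}pV permK.
by rewrite !pK.
Qed.

(** The region of an involution is symmetric. With uniqueness, this makes the avoiding rearrangement
    of an involution an involution. *)
Lemma flip_relV p q : (p^-1)%g = p -> flip_rel p q -> flip_rel p (q^-1)%g.
Proof.
move=> pV /flip_relP[H1 H2].
have pK : forall i, p (p i) = i by move=> i; rewrite -{1}pV permK.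
have iV i : inner p (p i) = inner p i.
  by rewrite /inner pK; apply/idP/idP; apply: below_ascent_sym.
apply/flip_relP; split=> i.
  have [k ->] : exists k, i = q k by exists ((q^-1)%g i); rewrite permKV.
  move=> ii; rewrite permK; apply: below_ascent_sym => //; apply: H1.
  by apply: contraLR (ii) => nk; rewrite H2 // iV.
move=> ni; have -> : i = q (p i) by rewrite H2 ?pK ?iV.
by rewrite permK H2 ?iV // pK.
Qed.

End Flip.

(** * From 1243 and 2134 to 1234 *)

Lemma p1243_val i : p1243 i = nth 0 [:: 0; 1; 3; 2] i :> nat.
Proof. by case: i => [[|[|[|[|i]]]] lt_i] //; rewrite permE. Qed.

Lemma p2134_val i : p2134 i = nth 0 [:: 1; 0; 2; 3] i :> nat.
Proof. by case: i => [[|[|[|[|i]]]] lt_i] //; rewrite permE. Qed.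

Lemma contains4P N (p : 'S_N) (sigma : 'S_4) (s : seq nat) :
  (forall i, sigma i = nth 0 s i :> nat) ->
  contains p sigma <-> exists a b c d : 'I_N,
    [/\ a < b < c, c < d &
     forall i j, i < 4 -> j < 4 ->
       (nth 0 [:: p a : nat; p b : nat; p c : nat; p d : nat] i
          < nth 0 [:: p a : nat; p b : nat; p c : nat; p d : nat] j)
       = (nth 0 s i < nth 0 s j)].
Proof.
move=> E; split.
  case/existsP=> f /andP[/forallP f1 /forallP f2].
  pose o k (lt_k : k < 4) := Ordinal lt_k.
  exists (f (@o 0 isT)), (f (@o 1 isT)), (f (@o 2 isT)), (f (@o 3 isT)); split.
  - apply/andP; split.
      by have /forallP/(_ (@o 1 isT)) := f1 (@o 0 isT).
    by have /forallP/(_ (@o 2 isT)) := f1 (@o 1 isT).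
  - by have /forallP/(_ (@o 3 isT)) := f1 (@o 2 isT).
  move=> i j lt_i lt_j.
  have H k (lt_k : k < 4) : nth 0 [:: p (f (@o 0 isT)) : nat; p (f (@o 1 isT)) : nat;
      p (f (@o 2 isT)) : nat; p (f (@o 3 isT)) : nat] k = p (f (Ordinal lt_k)).
    case: k lt_k => [|[|[|[|k]]]] lt_k //=; congr (nat_of_ord (p (f _))); exact: val_inj.
  rewrite !H; have /forallP/(_ (Ordinal lt_j))/eqP -> := f2 (Ordinal lt_i).
  by rewrite !E.
case=> a [b [c [d [abc cd H]]]]; apply/existsP.
pose g (i : nat) := nth a [:: a; b; c; d] i.
exists [ffun i : 'I_4 => g i]; apply/andP; split; apply/forallP => i; apply/forallP => j; rewrite !ffunE.
  by apply/implyP; case: i j => [[|[|[|[|i]]]] lt_i] [[|[|[|[|j]]]] lt_j] //=; rewrite /g /=; lia.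
rewrite !E -H //; apply/eqP.
have G (k : 'I_4) : nth 0 [:: p a : nat; p b : nat; p c : nat; p d : nat] k = p (g k).
  by case: k => [[|[|[|[|k]]]] lt_k].
by rewrite !G.
Qed.

Lemma contains2134P N (p : 'S_N) : contains p p2134 <-> has2134 p.
Proof.
rewrite (contains4P _ p2134_val); split=> [[a [b [c [d [abc cd H]]]]]|[a [b [c [d [abc cd ? ?]]]]]].
  exists a, b, c, d; have := H 1 0 isT isT; have := H 0 2 isT isT; have := H 2 3 isT isT.
  by rewrite /= => -> -> ->; split.
exists a, b, c, d; split=> // -[|[|[|[|i]]]] [|[|[|[|j]]]] //= _ _; lia.
Qed.

Definition has1243 N (p : 'S_N) := exists a b c d : 'I_N,
  [/\ a < b < c, c < d, p a < p b < p d & p d < p c].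

Lemma contains1243P N (p : 'S_N) : contains p p1243 <-> has1243 p.
Proof.
rewrite (contains4P _ p1243_val); split=> [[a [b [c [d [abc cd H]]]]]|[a [b [c [d [abc cd ? ?]]]]]].
  exists a, b, c, d; have := H 0 1 isT isT; have := H 1 3 isT isT; have := H 3 2 isT isT.
  by rewrite /= => -> -> ->; split.
exists a, b, c, d; split=> // -[|[|[|[|i]]]] [|[|[|[|j]]]] //= _ _; lia.
Qed.

Lemma reverse_alternatingP N (p : 'S_N) : reflect
  (forall i j : 'I_N, j = i.+1 :> nat -> if odd i then p i < p j else p j < p i)
  (reverse_alternating p).
Proof.
apply: (iffP forallP) => [H i j e|H i].
  by have /forallP/(_ j)/implyP := H i; apply; apply/eqP.
by apply/forallP => j; apply/implyP => /eqP; apply: H.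
Qed.

Lemma involutive_permP N (p : 'S_N) : reflect (p^-1 = p)%g (involutive_perm p).
Proof. by rewrite /involutive_perm eq_sym; apply: eqP. Qed.

(** * Reverse-complement as conjugation *)

Definition reversal N : 'S_N := perm (@rev_ord_inj N).

Lemma reversalE N (i : 'I_N) : reversal N i = rev_ord i.
Proof. by rewrite permE. Qed.

Lemma reversalV N : (reversal N)^-1%g = reversal N.
Proof. by apply/eqP; rewrite eq_invg_mul; apply/eqP/permP => i; rewrite permM !reversalE perm1 rev_ordK. Qed.

Lemma conj_reversalE N (p : 'S_N) i : (p ^ reversal N)%g i = rev_ord (p (rev_ord i)).
Proof. by rewrite conjgE reversalV !permM !reversalE. Qed.

(** The neighbours i, i+1 go to N-2-i, N-1-i in 0-based positions: their comparison is kept, and so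
    is the parity of the first one as N is even. *)
Lemma conj_reversal_reverse_alternating N (p : 'S_N) : ~~ odd N ->
  reverse_alternating p -> reverse_alternating (p ^ reversal N)%g.
Proof.
move=> evN /reverse_alternatingP H; apply/reverse_alternatingP => i j e.
have := H (rev_ord j) (rev_ord i); rewrite !conj_reversalE /=.
have := ltn_ord (p (rev_ord i)); have := ltn_ord (p (rev_ord j)); have := ltn_ord j.
rewrite e => lt_j lt1 lt2 /(_ ltac:(lia)).
have -> : odd (N - i.+2) = odd i by rewrite oddB // (negbTE evN) /= negbK.
by case: ifP => _; lia.
Qed.

Lemma conj_reversal_has1243 N (p : 'S_N) : has1243 (p ^ reversal N)%g <-> has2134 p.
Proof.
split=> -[a [b [c [d]]]].
  rewrite !conj_reversalE /= => -[? ? ? ?]; exists (rev_ord d), (rev_ord c), (rev_ord b), (rev_ord a).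
  have := ltn_ord (p (rev_ord a)); have := ltn_ord (p (rev_ord b)); have := ltn_ord (p (rev_ord c)).
  have := ltn_ord (p (rev_ord d)); have := ltn_ord d.
  by split=> /=; lia.
move=> [? ? ? ?]; exists (rev_ord d), (rev_ord c), (rev_ord b), (rev_ord a).
rewrite !conj_reversalE !rev_ordK /=.
have := ltn_ord (p a); have := ltn_ord (p b); have := ltn_ord (p c).
have := ltn_ord (p d); have := ltn_ord d.
by split=> /=; lia.
Qed.

Lemma card_RAI1243 N : ~~ odd N -> #|RAI N p1243| = #|RAI N p2134|.
Proof.
move=> evN; rewrite -[RHS](card_imset _ (conjg_inj (reversal N))).
congr #|pred_of_set _|; apply/setP => q; rewrite !inE.
have rK (p : 'S_N) : ((p ^ reversal N) ^ reversal N = p)%g.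
  by rewrite -conjgM -{1}reversalV mulVg conjg1.
have invJ (p : 'S_N) : involutive_perm p -> involutive_perm (p ^ reversal N)%g.
  by move/involutive_permP=> pV; apply/involutive_permP; rewrite -conjVg pV.
apply/and3P/imsetP => [[ra iv av]|[p]].
  exists (q ^ reversal N)%g; rewrite ?rK // inE; apply/and3P; split; [exact: conj_reversal_reverse_alternating|exact: invJ|].
  by apply: contra av => /contains2134P/conj_reversal_has1243; rewrite rK => /contains1243P.
rewrite inE => /and3P[ra iv av] ->; split; [exact: conj_reversal_reverse_alternating|exact: invJ|].
by apply: contra av => /contains1243P/conj_reversal_has1243/contains2134P.
Qed.

(** The third clause is avoidance of 1234 in the form of [has1234P]; the last quantifies over [a]
    because ['I_N] may be empty. *)
Definition outer_RAI1234 N : {set 'S_N} :=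
  [set p | [&& reverse_alternating p, involutive_perm p,
     [forall a : 'I_N, forall b : 'I_N, (a < b) && (p a < p b) ==> ~~ inner p b]
     & [forall a : 'I_N, (a == 0 :> nat) ==> ~~ inner p a]]].

Lemma outer_RAI1234P N (p : 'S_N) : reflect
  [/\ reverse_alternating p, involutive_perm p, ~ has1234 p &
      forall a : 'I_N, a = 0 :> nat -> ~~ inner p a]
  (p \in outer_RAI1234 N).
Proof.
rewrite inE; apply: (iffP and4P) => -[ra iv H H0]; split=> //.
- case/has1234P=> a [b [ab pab ib]].
  by have /forallP/(_ a)/forallP/(_ b) := H; rewrite ab pab ib.
- by move=> a a0; have /forallP/(_ a)/implyP := H0; apply; apply/eqP.
- apply/forallP => a; apply/forallP => b; apply/implyP => /andP[ab pab].
  by apply/negP => ib; apply: H; apply/has1234P; exists a, b.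
- by apply/forallP => a; apply/implyP => /eqP; apply: H0.
Qed.

(** * Rearrangement of alternating involutions *)

Section Peaks.
Variables (N : nat) (evN : ~~ odd N).
Implicit Types p q : 'S_N.

Definition outer_peaks p := forall i : 'I_N, ~~ odd i -> ~~ inner p i.

(** An inner peak and the valley after it, which exists as N is even, form 2134 with the ascent
    above the peak. *)
Lemma outer_peaks2134 p : reverse_alternating p -> ~ has2134 p -> outer_peaks p.
Proof.
move=> /reverse_alternatingP H A i ev_i; apply/negP => ii.
have lt_i : i.+1 < N by have := ltn_ord i; case: (ltngtP i.+1 N) => // e; move: evN; rewrite -e /= ev_i.
have := H i (Ordinal lt_i) erefl; rewrite (negbTE ev_i) => lt.
case/below_ascentP: ii => a [b [ia ab pia pab]].
apply: A; exists i, (Ordinal lt_i), a, b; split=> //=; last by rewrite lt.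
rewrite ltnSn /= ltn_neqAle ia andbT; apply: contraTneq pia => e.
by rewrite -leqNgt ltnW // (_ : a = Ordinal lt_i) //; apply: val_inj.
Qed.

(** A later inner peak would form 1234 with the valley before it and the ascent above it; only the
    first peak needs the extra hypothesis. *)
Lemma outer_peaks1234 p : reverse_alternating p -> ~ has1234 p ->
  (forall a : 'I_N, a = 0 :> nat -> ~~ inner p a) -> outer_peaks p.
Proof.
move=> /reverse_alternatingP H A H0 i ev_i; apply/negP => ii.
case: (posnP i) => [/H0|i_gt0]; first by rewrite ii.
have lt_i : i.-1 < N by have := ltn_ord i; lia.
have ei : i = (Ordinal lt_i).+1 :> nat by rewrite /= prednK.
have := H (Ordinal lt_i) i ei.
have -> : odd (Ordinal lt_i) by move: ev_i; rewrite -{1}(prednK i_gt0) /= negbK.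
by move=> lt; apply: A; apply/has1234P; exists (Ordinal lt_i), i; split=> //=; lia.
Qed.

(** Peaks are fixed. A valley moved above an adjacent peak would still lie in the region, forcing
    that peak into it. *)
Lemma flip_reverse_alternating p q : flip_rel p q -> outer_peaks p ->
  reverse_alternating p -> reverse_alternating q.
Proof.
move=> /flip_relP[H1 H2] O /reverse_alternatingP H; apply/reverse_alternatingP => i j e.
have ne : q i != q j :> nat.
  by apply/eqP => /val_inj/perm_inj ij; move: e; rewrite ij; lia.
case: ifP => oi.
  have Oj := O j; rewrite e /= oi in Oj; have {}Oj := Oj isT.
  have := H i j e; rewrite oi -(H2 j) // => lt.
  case Ei: (inner p i); last by rewrite H2 // Ei.
  rewrite ltn_neqAle ne leqNgt; apply/negP => lt'.
  have := H1 _ Ei => /below_ascentP[a [b [ia ab qia pab]]].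
  have qj := H2 _ Oj; case/negP: Oj; apply/below_ascentP; exists a, b; rewrite -qj; split=> //; last by lia.
  rewrite e ltn_neqAle ia andbT; apply/eqP => ja.
  have {}ja : j = a by apply: val_inj; rewrite /= e.
  by move: qia; rewrite -ja -qj; lia.
have Oi := O i (negbT oi); have := H i j e; rewrite oi -(H2 i) // => lt.
case Ej: (inner p j); last by rewrite (H2 j) // Ej.
rewrite ltn_neqAle eq_sym ne leqNgt; apply/negP => lt'.
have qi := H2 _ Oi; case/negP: Oi; rewrite /inner -qi.
by apply: (below_ascent_down (H1 _ Ej)); lia.
Qed.

Lemma flip_outer_peaks p q : flip_rel p q -> outer_peaks p -> outer_peaks q.
Proof. by move=> R O i /O; rewrite (inner_flip _ R). Qed.

Lemma flip1234_RAI p : p \in RAI N p2134 -> flip1234 p \in outer_RAI1234 N.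
Proof.
rewrite inE => /and3P[ra /[dup] iv /involutive_permP pV /negP av].
have {}av : ~ has2134 p by move/contains2134P.
have O := outer_peaks2134 ra av; have [R A] := flip1234P p.
apply/outer_RAI1234P; split=> //.
- exact: flip_reverse_alternating R O ra.
- apply/involutive_permP; apply: (flip1234_uniq (flip_relV pV R) R) => //.
  by move/has1234V; rewrite invgK.
- by move=> a a0; apply: (flip_outer_peaks R O); rewrite a0.
Qed.

Lemma flip2134_RAI p : p \in outer_RAI1234 N -> flip2134 p \in RAI N p2134.
Proof.
case/outer_RAI1234P=> ra /[dup] iv /involutive_permP pV av p0.
have O := outer_peaks1234 ra av p0; have [R A] := flip2134P p.
rewrite inE; apply/and3P; split.
- exact: flip_reverse_alternating R O ra.
- apply/involutive_permP; apply: (flip2134_uniq (flip_relV pV R) R) => //.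
  by move/has2134V; rewrite invgK.
- by apply/negP => /contains2134P.
Qed.

Lemma card_RAI2134 : #|RAI N p2134| = #|outer_RAI1234 N|.
Proof.
apply/eqP; rewrite eqn_leq; apply/andP; split.
  rewrite -(@card_in_imset _ _ (@flip1234 N) (mem (RAI N p2134))).
    by apply: subset_leq_card; apply/subsetP => _ /imsetP[p Hp ->]; apply: flip1234_RAI.
  apply: (@can_in_inj _ _ _ _ (@flip2134 N)) => p; rewrite inE => /and3P[_ _ /negP av].
  have [R _] := flip1234P p; have [R' A'] := flip2134P (flip1234 p).
  by apply: (flip2134_uniq (flip_rel_trans R R') (flip_rel_refl p)) => // /contains2134P.
rewrite -(@card_in_imset _ _ (@flip2134 N) (mem (outer_RAI1234 N))).
  by apply: subset_leq_card; apply/subsetP => _ /imsetP[p Hp ->]; apply: flip2134_RAI.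
apply: (@can_in_inj _ _ _ _ (@flip1234 N)) => p /outer_RAI1234P[_ _ av _].
have [R _] := flip2134P p; have [R' A'] := flip1234P (flip2134 p).
exact: (flip1234_uniq (flip_rel_trans R R') (flip_rel_refl p)).
Qed.
End Peaks.

(** * Deleting the first 2-cycle *)

Definition increasing4 (n : nat) (f : nat -> nat) :=
  exists a b c d, [/\ a < b < c, c < d < n, f a < f b < f c & f c < f d].

Definition outer_spec (N : nat) (F : nat -> nat) :=
  [/\ involution_on N F,
      forall i, i.+1 < N -> if odd i then F i < F i.+1 else F i.+1 < F i,
      ~ increasing4 N F
    & forall a b, 0 < a -> a < b -> b < N -> F 0 < F a -> F a < F b -> False].

Lemma involution_on_inj n f i j : involution_on n f -> i < n -> j < n -> f i = f j -> i = j.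
Proof. by move=> fI lt_i lt_j e; have [_ <-] := fI _ lt_i; have [_ <-] := fI _ lt_j; rewrite e. Qed.

(** The value 0 is at position k = F 0, a valley, so k is odd. If k + 3 < 2n, the ascent at k + 2
    gives, through the involution, the values k + 2 and k + 3 in increasing order, making the first
    point inner. *)
Lemma outer_spec_first n F : 0 < n -> outer_spec (2 * n) F ->
  F 0 = (2 * n).-1 \/ (1 < n /\ F 0 = 2 * n - 3).
Proof.
move=> n_gt0 [FI alt _ O]; have lt0 : 0 < 2 * n by lia.
have [lt_k Fk] := FI 0 lt0; set k := F 0 in lt_k Fk *.
have odd_k : odd k.
  apply: contraT => ev_k; have lt_k1 : k.+1 < 2 * n by lia.
  by have := alt k lt_k1; rewrite (negbTE ev_k) Fk.
case: (leqP (2 * n) k.+3) => [|lt3]; first lia.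
have := alt k.+2 lt3; rewrite /= negbK odd_k => lt.
have [l2 F2] := FI k.+2 (ltnW lt3); have [l3 F3] := FI k.+3 lt3.
have pos : 0 < F k.+2.
  by rewrite lt0n; apply/eqP => e; move: F2; rewrite e -/k; lia.
by exfalso; apply: (O (F k.+2) (F k.+3)); rewrite ?F2 ?F3 -/k //; lia.
Qed.

(* [b] tells the two cases apart: in a permutation of N = 2(P + b) + 2 points the
   first one is mapped to k = N - 1 or k = N - 3, that is to 2P + 1. *)
Section Reduction.
Variables (b : bool) (P : nat).
Let k := (2 * P).+1.
Let L := 2 * (P + b).
Let N := L.+2.

(** The increasing bijection onto the positions other than 0 and [k]; [remove_gap] inverts it. *)
Definition insert_gap i := if i.+1 < k then i.+1 else i.+2.
Definition remove_gap x := if x < k then x.-1 else x.-2.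

(** Before the gap the shift by one exchanges peaks and valleys; after it only the descent at 2P can
    remain. The two neighbours of the deleted point [k] are not compared. *)
Definition good_involution f :=
  [/\ involution_on L f, ~ increasing4 L f &
   forall i, i.+1 < L -> i.+1 <> 2 * P -> (f i < f i.+1) = ~~ odd i && (i < 2 * P)].

Definition reduce (F : nat -> nat) i := remove_gap (F (insert_gap i)).
Definition extend (f : nat -> nat) x :=
  if x == 0 then k else if x == k then 0 else insert_gap (f (remove_gap x)).

Lemma insert_gapP i : i < L -> [/\ 0 < insert_gap i < N, insert_gap i <> k & remove_gap (insert_gap i) = i].
Proof.
rewrite /insert_gap /remove_gap => lt_i; case: (ltnP i.+1 k) => h.
  by rewrite h; move: h; rewrite /N /L /k in lt_i *; split; lia.
rewrite [i.+2 < k]ltnNge (leqW h); move: h; rewrite /N /L /k in lt_i *; split=> //; lia.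
Qed.

Lemma remove_gapP x : 0 < x < N -> x <> k -> remove_gap x < L /\ insert_gap (remove_gap x) = x.
Proof.
rewrite /insert_gap /remove_gap => lt_x ne; case: (ltnP x k) => h.
  rewrite (_ : x.-1.+1 < k = true); last lia.
  by move: h; rewrite /N /L /k in lt_x *; split; lia.
rewrite (_ : x.-2.+1 < k = false); last by rewrite /k in ne h *; lia.
by move: h; rewrite /N /L /k in lt_x ne *; split; lia.
Qed.

Lemma ltn_insert_gap i j : (insert_gap i < insert_gap j) = (i < j).
Proof. by rewrite /insert_gap; case: (ltnP i.+1 k) => ?; case: (ltnP j.+1 k) => ?; apply/idP/idP; lia. Qed.

Section Reduce.
Variable F : nat -> nat.
Hypotheses (FS : outer_spec N F) (F0 : F 0 = k).

Lemma outer_spec_k : F k = 0.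
Proof. by have [FI _ _ _] := FS; have [_] := FI 0 isT; rewrite F0. Qed.

Lemma reduceE i : i < L -> insert_gap (reduce F i) = F (insert_gap i) /\ reduce F i < L.
Proof.
move=> lt_i; have [/andP[gt0 ltN] nk rK] := insert_gapP lt_i.
have [FI _ _ _] := FS; have [ltF FK] := FI _ ltN.
have [] // := @remove_gapP (F (insert_gap i)).
  apply/andP; split=> //; rewrite lt0n; apply/eqP => e; apply: nk.
  by rewrite -FK e F0.
by move=> e; rewrite e outer_spec_k in FK; rewrite -FK in gt0.
Qed.

Lemma reduce_good : good_involution (reduce F).
Proof.
have [FI alt A4 O] := FS; split.
- move=> i lt_i; have [e lt_r] := reduceE lt_i; split=> //.
  have [/andP[gt0 ltN] nk rK] := insert_gapP lt_i; have [ltF FK] := FI _ ltN.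
  by rewrite {1}/reduce e FK rK.
- case=> a [c [d [e [acd deL F1 F2]]]]; apply: A4.
  have la : a < L by lia. have lc : c < L by lia. have ld : d < L by lia. have le : e < L by lia.
  have [ea _] := reduceE la; have [ec _] := reduceE lc.
  have [ed _] := reduceE ld; have [ee _] := reduceE le.
  exists (insert_gap a), (insert_gap c), (insert_gap d), (insert_gap e).
  rewrite -ea -ec -ed -ee !ltn_insert_gap; split=> //.
  by have [/andP[_ ->] _ _] := insert_gapP le; case/andP: deL => -> _.
- move=> i lt_i ne; have lt_i' := ltnW lt_i.
  have [e1 _] := reduceE lt_i'; have [e2 _] := reduceE lt_i.
  rewrite -ltn_insert_gap e1 e2.
  have e : insert_gap i.+1 = (insert_gap i).+1.
    by rewrite /insert_gap; case: (ltnP i.+2 k) => h1; case: (ltnP i.+1 k) => h2; rewrite /k in h1 h2; lia.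
  have [/andP[_ ltN] _ _] := insert_gapP lt_i; rewrite e in ltN *.
  have := alt _ ltN; rewrite {1}/insert_gap.
  case: (ltnP i.+1 k) => h /=.
    have -> : i < 2 * P by lia.
    by rewrite andbT; case: (odd i) => /=; lia.
  have ei : i = 2 * P by move: lt_i; rewrite /L; case: (b) => /=; lia.
  rewrite {1}ei negbK oddM /= => lt; rewrite ei in lt *.
  by rewrite ltnn andbF; apply/negbTE; rewrite -leqNgt ltnW.
Qed.

End Reduce.

Lemma reduce_inj F F' : outer_spec N F -> F 0 = k -> outer_spec N F' -> F' 0 = k ->
  (forall i, i < L -> reduce F i = reduce F' i) -> forall x, x < N -> F x = F' x.
Proof.
move=> FS F0 FS' F0' E x lt_x.
case: (posnP x) => [->|gt0]; first by rewrite F0.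
case: (x =P k) => [->|nk]; first by rewrite !outer_spec_k.
have [] := @remove_gapP x; rewrite ?gt0 // => lt_r <-.
have [<- _] := reduceE FS F0 lt_r; have [<- _] := reduceE FS' F0' lt_r.
by rewrite E.
Qed.

Lemma extend_reduce f i : involution_on L f -> i < L -> reduce (extend f) i = f i.
Proof.
move=> fI lt_i; rewrite /reduce /extend.
have [/andP[gt0 ltN] /eqP nk rK] := insert_gapP lt_i.
rewrite eqn0Ngt gt0 (negbTE nk) /= rK.
by have [lt_f _] := fI _ lt_i; have [_ _ ->] := insert_gapP lt_f.
Qed.

Lemma extendE f i : i < L -> extend f (insert_gap i) = insert_gap (f i).
Proof.
move=> lt_i; have [/andP[gt0 ltN] /eqP nk rK] := insert_gapP lt_i.
by rewrite /extend eqn0Ngt gt0 (negbTE nk) /= rK.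
Qed.

Lemma gap_cases x : x < N -> [\/ x = 0, x = k | exists2 i, i < L & x = insert_gap i].
Proof.
move=> lt_x; case: (posnP x) => [->|gt0]; first by constructor 1.
case: (x =P k) => [->|nk]; first by constructor 2.
by constructor 3; have [] := @remove_gapP x; rewrite ?gt0 //; exists (remove_gap x).
Qed.

Lemma extend_outer f : good_involution f -> outer_spec N (extend f).
Proof.
case=> fI A4 alt.
have e0 : extend f 0 = k by [].
have ek : extend f k = 0 by rewrite /extend eqxx.
have FI : involution_on N (extend f).
  move=> x /gap_cases[->|->|[i lt_i ->]]; rewrite ?e0 ?ek //.
  - by rewrite /N /L /k; lia.
  - have [lt_f fK] := fI _ lt_i; rewrite !extendE // fK.
    by have [/andP[_ ->]] := insert_gapP lt_f.
(* Only k+1 and k+2 can exceed [k], and their positions are ordered by the descent of [f] at 2P. *)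
have O a c : 0 < a -> a < c -> c < N -> extend f 0 < extend f a -> extend f a < extend f c -> False.
  move=> a0 ac cN; rewrite e0 => ka fac.
  have [lta ea] := FI a (ltn_trans ac cN); have [ltc ec] := FI c cN.
  have [l2P b1 ea2 ec2] : [/\ (2 * P).+1 < L, b, extend f a = k.+1 & extend f c = k.+2].
    by move: lta ltc ka fac; rewrite /k /N /L; case: (b) => /=; split; lia.
  rewrite ea2 in ea; rewrite ec2 in ec.
  have i1 : k.+1 = insert_gap (2 * P) by rewrite /insert_gap /k ltnn.
  have i2 : k.+2 = insert_gap (2 * P).+1 by rewrite /insert_gap /k; case: ltnP => //; lia.
  rewrite i1 extendE ?(ltnW l2P) // in ea; rewrite i2 extendE // in ec.
  move: ac; rewrite -ea -ec ltn_insert_gap alt ?ltnn ?andbF //; lia.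
split=> //.
- move=> i lt_i.
  have fne j : j.+1 < L -> f j <> f j.+1.
    by move=> lt_j /(involution_on_inj fI (ltnW lt_j) lt_j); lia.
  have [/eqP->|i0] := boolP (i == 0).
    rewrite e0 /=; have [/eqP P0|P0] := boolP (P == 0).
      by have -> : 1 = k by [rewrite /k P0]; rewrite ek.
    have L0 : 0 < L by rewrite /L; lia.
    have -> : 1 = insert_gap 0 by rewrite /insert_gap; case: (ltnP 1 k) => //; rewrite /k; lia.
    rewrite extendE //.
    (* Otherwise the ascent at 0 forces f 0 = 2P and f 1 = 2P + 1, against the descent at 2P. *)
    have lt_f0 : f 0 < 2 * P.
      have [lt_f f0] := fI 0 L0; rewrite ltnNge; apply/negP => le.
      have L1 : 1 < L by rewrite /L; lia.
      have := alt 0 L1; rewrite /= (_ : 0 < 2 * P); last lia.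
      move=> lt01; have {}lt01 : f 0 < f 1 by rewrite lt01; lia.
      have [lt_f1 f1] := fI 1 L1.
      have [f0e f1e] : f 0 = 2 * P /\ f 1 = (2 * P).+1 by move: lt_f lt_f1; rewrite /L; case: (b) => /=; lia.
      rewrite f0e in f0; rewrite f1e in f1.
      have l : (2 * P).+1 < L by lia.
      by have := alt _ l; rewrite f0 f1 ltnn andbF => H; have := H ltac:(lia).
    by rewrite /insert_gap; case: (ltnP (f 0).+1 k) => h; rewrite /k in h *; lia.
  have [/eqP ik|ik] := boolP (i == k).
    have ok : odd k by rewrite /k /= oddM.
    rewrite ik ok ek lt0n; apply/eqP => e; rewrite ik in lt_i.
    by have [_] := FI _ lt_i; rewrite e e0; lia.
  have [/eqP ik1|ik1] := boolP (i.+1 == k).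
    have ev : odd i = false by move: ik1; rewrite /k => -[->]; rewrite oddM.
    rewrite ev ik1 ek lt0n; apply/eqP => e; have [_] := FI _ (ltnW lt_i); rewrite e e0; lia.
  have [j [lt_j ei ei1 ne]] : exists j, [/\ j.+1 < L, i = insert_gap j, i.+1 = insert_gap j.+1 & j.+1 <> 2 * P].
    exists (remove_gap i); move: lt_i i0 ik ik1; rewrite /insert_gap /remove_gap /k /N => lt_i i0 ik ik1.
    by case: (ltnP i) => h; split; try case: ltnP; lia.
  rewrite ei1 ei !extendE ?(ltnW lt_j) // !ltn_insert_gap; have := alt _ lt_j ne; have := fne _ lt_j.
  rewrite -ei /insert_gap.
  have -> : odd i = ~~ odd j && (j < 2 * P).
    move: ei; rewrite /insert_gap /k; case: ltnP => h -> /=.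
      by rewrite (_ : j < 2 * P) ?andbT //; lia.
    have -> : j = 2 * P by move: lt_j; rewrite /L; case: (b) => /=; lia.
    by rewrite ltnn andbF negbK oddM.
  by move=> ? <-; case: ltnP => // ?; lia.
- move=> [a [c [d [e [acd de F1 F2]]]]].
  (* The new points take no part: a pattern starting at 0 contradicts [O], at most two positions
     follow [k], and the value 0 at [k] can only come first. *)
  have a0 : a <> 0.
    move=> a0; rewrite a0 in acd F1; apply: (O c d); lia.
  have ak : a <> k.
    by move=> ak; move: acd de; rewrite ak /k /N /L; case: (b) => /=; lia.
  have gap x : x < N -> x <> 0 -> x <> k -> exists2 i, i < L & x = insert_gap i.
    by case/gap_cases.
  have pos x y : extend f x < extend f y -> y <> k by move=> lt ek'; rewrite ek' ek in lt.
  have [/andP[fac fcd] fde] := (F1, F2).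
  have [i li ea] : exists2 i, i < L & a = insert_gap i by apply: gap => //; lia.
  have [j lj ec] : exists2 i, i < L & c = insert_gap i by apply: gap; [lia|lia|exact: pos fac].
  have [l ll ed] : exists2 i, i < L & d = insert_gap i by apply: gap; [lia|lia|exact: pos fcd].
  have [m lm ee] : exists2 i, i < L & e = insert_gap i by apply: gap; [lia|lia|exact: pos fde].
  apply: A4; exists i, j, l, m.
  move: acd de F1 F2; rewrite ea ec ed ee !extendE // !ltn_insert_gap => ? /andP[-> _] ? ?.
  by split.
Qed.
End Reduction.

(** * Counting *)

Lemma eq_tableau_word n f g : (forall i, i < n -> f i = g i) ->
  tableau_word n f = tableau_word n g.
Proof.
move=> E; apply/eq_in_map => j _; congr odflt; apply: growth_ext (leqnn _) _ => i j' lt_i.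
by rewrite /graph_on lt_i E.
Qed.

(** Avoiding 1234 bounds the first row by 3, hence the number of columns; ascents and descents pass
    to the word. *)
Lemma tableau_word_good b P f : good_involution b P f ->
  tableau_word (2 * (P + b)) f \in paired_words b P 0 0 0.
Proof.
case=> fI A4 alt; rewrite mem_paired_words //.
have cw : three_columns 0 0 0 (tableau_word (2 * (P + b)) f).
  apply/three_columnsP => //; split; last by move=> j r; exact: tableau_word_ballot.
  by rewrite add0n leqNgt; apply/negP => /(tableau_word_increasing4 fI).
rewrite cw; apply/(paired_alternating _ _ _ cw) => //; rewrite size_tableau_word; split=> // i.
rewrite size_tableau_word => lt_i ne.
rewrite leqNgt tableau_word_descent // -alt // -leqNgt leq_eqVlt.
by case: eqP => //= /(involution_on_inj fI (ltnW lt_i) lt_i); lia.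
Qed.

Lemma paired_word_tableau b P s : s \in paired_words b P 0 0 0 ->
  exists2 f, good_involution b P f & tableau_word (2 * (P + b)) f = s.
Proof.
rewrite mem_paired_words // => /andP[cw /(paired_alternating b P (isT : 0 <= 0 <= 0) cw)[es alt]].
have [le3 ballot_s] := (three_columnsP s (isT : 0 <= 0 <= 0)).2 cw.
have [f] := @tableau_word_surj s ballot_s; rewrite es => fI ef; exists f => //; split=> //.
  move/(tableau_word_increasing4 fI); rewrite ef.
  by move: le3; rewrite add0n leqNgt => /negP.
move=> i lt_i ne; rewrite -alt ?es // [RHS]leqNgt -ef tableau_word_descent // -leqNgt [RHS]leq_eqVlt.
by case: eqP => //= /(involution_on_inj fI (ltnW lt_i) lt_i); lia.
Qed.

Definition perm_nat N (p : 'S_N) (i : nat) : nat :=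
  if insub i is Some x then p x else 0.

Lemma perm_natE N (p : 'S_N) (i : 'I_N) : perm_nat p i = p i.
Proof. by rewrite /perm_nat valK. Qed.

Lemma outer_RAI1234_spec N (p : 'S_N) : 0 < N ->
  p \in outer_RAI1234 N <-> outer_spec N (perm_nat p).
Proof.
move=> N0; have pE i (lt_i : i < N) : perm_nat p i = p (Ordinal lt_i) by rewrite -(perm_natE p (Ordinal lt_i)).
split=> [/outer_RAI1234P[/reverse_alternatingP ra /involutive_permP pV A4 O]|[FI alt A4 O]].
  split.
  - move=> i lt_i; rewrite (pE _ lt_i) perm_natE; split; first exact: ltn_ord.
    by rewrite -{1}pV permK.
  - move=> i lt_i; have := ra (Ordinal (ltnW lt_i)) (Ordinal lt_i) erefl.
    by rewrite (pE _ (ltnW lt_i)) (pE _ lt_i).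
  - move=> [a [b [c [d [abc cd F1 F2]]]]]; apply: A4.
    have la : a < N by lia. have lb : b < N by lia. have lc : c < N by lia. have ld : d < N by lia.
    rewrite (pE _ la) (pE _ lb) (pE _ lc) in F1; rewrite (pE _ lc) (pE _ ld) in F2.
    by exists (Ordinal la), (Ordinal lb), (Ordinal lc), (Ordinal ld); split=> //; case/andP: cd.
  move=> a b a0 ab bN; have aN := ltn_trans ab bN; rewrite (pE _ N0) (pE _ aN) (pE _ bN) => F1 F2.
  have /negP := O (Ordinal N0) erefl; apply; apply/below_ascentP.
  by exists (Ordinal aN), (Ordinal bN).
apply/outer_RAI1234P; split.
- apply/reverse_alternatingP => i j e; have := alt i; rewrite -e ltn_ord !perm_natE; exact.
- apply/involutive_permP; apply/permP => i; apply: (@perm_inj _ p); rewrite permKV.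
  by apply: val_inj; have [_] := FI i (ltn_ord i); rewrite !perm_natE.
- move=> [a [b [c [d [abc cd F1 F2]]]]]; apply: A4; exists a, b, c, d.
  by rewrite !perm_natE; split=> //; rewrite cd ltn_ord.
- move=> i i0; apply/negP => /below_ascentP[a [b [ia ab F1 F2]]].
  apply: (O a b); rewrite ?perm_natE ?ltn_ord //; first by rewrite -i0.
  by rewrite -i0 perm_natE.
Qed.

Lemma perm_of_involution N F : involution_on N F ->
  exists p : 'S_N, forall i, i < N -> perm_nat p i = F i.
Proof.
move=> FI; pose g (i : 'I_N) := Ordinal (FI i (ltn_ord i)).1.
have gK : involutive g by move=> i; apply: val_inj; exact: (FI i (ltn_ord i)).2.
exists (perm (inv_inj gK)) => i lt_i.
by rewrite -[i]/(val (Ordinal lt_i)) perm_natE permE.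
Qed.

Lemma eq_outer_spec N F G : 0 < N -> (forall i, i < N -> F i = G i) ->
  outer_spec N F -> outer_spec N G.
Proof.
move=> N0 E [FI alt A4 O]; split.
- by move=> i lt_i; have [lt_f fK] := FI i lt_i; rewrite -!E // -E.
- by move=> i lt_i; have := alt i lt_i; rewrite !E // ltnW.
- move=> [a [b [c [d [abc cd F1 F2]]]]]; apply: A4; exists a, b, c, d.
  by rewrite !E //; lia.
- move=> a b a0 ab bN; rewrite -!E //; first exact: O; lia.
Qed.

Lemma card_outer_first (b : bool) P N : N = (2 * (P + b)).+2 ->
  #|[set p in outer_RAI1234 N | perm_nat p 0 == (2 * P).+1]| = size (paired_words b P 0 0 0).
Proof.
move=> ->; set A := [set p in _ | _].
pose g p := tableau_word (2 * (P + b)) (reduce P (@perm_nat (2 * (P + b)).+2 p)).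
have AP p : p \in A <-> outer_spec (2 * (P + b)).+2 (perm_nat p) /\ perm_nat p 0 = (2 * P).+1.
  rewrite inE; split=> [/andP[/outer_RAI1234_spec H /eqP]|[H ->]]; first by split=> //; apply: H.
  by rewrite eqxx andbT; apply/outer_RAI1234_spec.
have gI : {in enum A &, injective g}.
  move=> p q; rewrite !mem_enum => /AP[pS p0] /AP[qS q0] E.
  have [pI _ _] := reduce_good pS p0; have [qI _ _] := reduce_good qS q0.
  apply/permP => i; apply: val_inj; rewrite /= -!perm_natE.
  apply: (reduce_inj pS p0 qS q0) => //; exact: (tableau_word_inj pI qI E).
rewrite cardE -(size_map g); apply: perm_size; apply: uniq_perm.
- by rewrite map_inj_in_uniq ?enum_uniq.
- exact: uniq_paired_words.
move=> s; apply/mapP/idP => [[p]|].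
  rewrite mem_enum => /AP[pS p0] ->; apply: tableau_word_good; exact: reduce_good.
case/paired_word_tableau=> f fG <-.
have [eI _ _ _] := extend_outer fG; have [p pE] := perm_of_involution eI.
have pA : p \in A.
  apply/AP; split; last by rewrite pE.
  by apply: eq_outer_spec (extend_outer fG) => // i lt_i; rewrite pE.
exists p; first by rewrite mem_enum.
have [fI _ _] := fG; apply: eq_tableau_word => i lt_i.
by rewrite -(extend_reduce fI lt_i) /reduce pE //; have [/andP[_ ->] _ _] := insert_gapP lt_i.
Qed.

(** With [n] now one less, the two images of the first point contribute the walks of n steps and the
    difference of those of n + 1 and n steps. *)
Lemma card_outer_RAI1234 n : 0 < n -> #|outer_RAI1234 (2 * n)| = motzkin n.
Proof.
case: n => // n _; set N := 2 * n.+1; rewrite -chamber_walks0.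
pose A k := [set p in outer_RAI1234 N | perm_nat p 0 == k].
have AE k p : (p \in A k) = (p \in outer_RAI1234 N) && (perm_nat p 0 == k) by exact: in_set.
have first p : p \in outer_RAI1234 N -> perm_nat p 0 = N.-1 \/ (1 < n.+1 /\ perm_nat p 0 = N - 3).
  by move=> /outer_RAI1234_spec H; apply: outer_spec_first => //; apply: H.
have A1 : #|A N.-1| = chamber_walks n 0 0.
  rewrite -(@size_paired_words_false n 0 0 0 0 0) // -(@card_outer_first false n N); last by rewrite /N; lia.
  by congr #|pred_of_set _|; apply/setP => p; rewrite AE [RHS]in_set; congr (_ && (_ == _)); rewrite /N; lia.
(* For N = 2 only the first image is possible. *)
case: n @N A AE first A1 => [|n] N A AE first A1.
  rewrite -[RHS]A1; congr #|pred_of_set _|; apply/setP => p.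
  rewrite AE; case E: (p \in outer_RAI1234 N) => //=.
  by have [->|[]] := first p E; rewrite ?eqxx.
have A3 : #|A (N - 3)| = size (paired_words true n 0 0 0).
  rewrite -(@card_outer_first true n N); last by rewrite /N; lia.
  by congr #|pred_of_set _|; apply/setP => p; rewrite AE [RHS]in_set; congr (_ && (_ == _)); rewrite /N; lia.
rewrite -(@size_paired_words_true n 0 0 0) // -A3 -A1 addnC.
have -> : outer_RAI1234 N = A N.-1 :|: A (N - 3).
  apply/setP => p; rewrite in_setU !AE -andb_orr; case E: (p \in outer_RAI1234 N) => //=.
  by have [->|[_ ->]] := first p E; rewrite eqxx ?orbT.
rewrite cardsU (_ : _ :&: _ = set0) ?cards0 ?subn0 //.
apply/setP => p; rewrite in_setI !AE in_set0; apply/negP => /andP[/andP[_ /eqP e] /andP[_ /eqP e']].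
by move: e'; rewrite e /N; lia.
Qed.

Theorem mainTheorem3 (n : nat) (hn : 1 <= n) :
  #|RAI (2 * n) p1243| = motzkin n /\ #|RAI (2 * n) p2134| = motzkin n.
Proof.
have ev : ~~ odd (2 * n) by rewrite oddM.
by rewrite card_RAI1243 // card_RAI2134 // card_outer_RAI1234.
Qed.
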